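(* Let $0<\theta<\theta_0\le\infty$. There exists a real-valued random variable $H_\theta^\infty$, whose law may depend on $\theta$ (and the law of $Z$) but not on $\mu$, such that for every probability measure $\mu\neq\delta_0$ on $[0,\infty)$ with finite mean $\langle\mu\rangle$, as $n\to\infty$, $$R_n^*(\theta,\mu)-\frac{\nu(\theta)}{\theta}\,n\ \Rightarrow\ H_\theta^\infty+\frac1\theta\log\langle\mu\rangle,$$ where $\Rightarrow$ denotes convergence in distribution.
   Context: Branching random walk (BRW). Let $Z=\sum_{j=1}^N\delta_{\xi_j}$ be a point process on $\mathbb R$ with $N:=Z(\mathbb R)<\infty$ a.s. Start with one particle at $0$ in generation $0$. Each particle of generation $n-1$ independently produces offspring (generation $n$) whose displacements from the parent's position are the atoms of an independent copy of $Z$. For a particle $v$, $|v|$ is its generation and $S(v)$ its position. Let $m(\theta):=\mathbb E\left[\sum_{j=1}^N e^{\theta\xi_j}\right]$ and $\nu:=\log m$. Standing assumptions: (A1) there is $\vartheta>0$ with $m(\theta)<\infty$ for all $\theta\in(-\vartheta,\infty)$; (A2) $\mathbb P(N=1)<1$, $\mathbb P(Z(\{t\})=N)<1$ for every $t\in\mathbb R$, and $\mathbb P(N\ge1)=1$; (A3) $\mathbb E[N^{1+p}]<\infty$ for some $p>0$. $\theta_0:=\inf\{\theta>0:\nu(\theta)/\theta=\nu'(\theta)\}\in(0,\infty]$, with $\inf\emptyset=\infty$ (the set has at most one element). Last progeny modified BRW. Given $\theta>0$ and $\mu$, for each $n\ge1$ let $\{Y_v\}_{|v|=n}$ be i.i.d.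 with law $\mu$ and $\{E_v\}_{|v|=n}$ i.i.d. Exponential(1), independent of each other and of $(S(u))_{|u|\le n}$. With $\log 0=-\infty$, $$R_n^*(\theta,\mu):=\max_{|v|=n}\left\{S(v)+\tfrac1\theta\left(\log Y_v-\log E_v\right)\right\}.$$ *)

(* Defs.v *)
From HB Require Import structures.
From mathcomp Require Import all_boot all_order all_algebra finmap.
From mathcomp Require Import all_classical all_reals all_analysis.

Set Implicit Arguments.
Unset Strict Implicit.
Unset Printing Implicit Defensive.

Import Order.TTheory GRing.Theory Num.Theory.
Import numFieldNormedType.Exports.

Local Open Scope classical_set_scope.
Local Open Scope ring_scope.

Definition mutually_independent d (T : measurableType d) (R : realType)
    (P : probability T R) (I : choiceType) (F : I -> set_system T) : Prop :=
  forall (J : {fset I}) (A : I -> set T), (forall i, i \in J -> F i (A i)) ->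
    P (\bigcap_(i in [set` J]) A i) = (\prod_(i <- J) P (A i))%E.

(* Convergence in distribution of [-oo, +oo]-valued X n to a real-valued L:
   convergence of the distribution functions at every continuity point of that
   of L. *)
Definition cvg_in_distribution d (T : measurableType d) (R : realType)
    (P : probability T R) (X : nat -> T -> \bar R)
    d' (T' : measurableType d') (P' : probability T' R) (L : T' -> R) : Prop :=
  let F := fun x : R => P' [set w | L w <= x] in
  forall x : R, {for x, continuous F} ->
    P [set w | (X n w <= x%:E)%E] @[n --> \oo] --> F x.

(* A random finite collection of points pts 0, ..., pts (npts - 1);
   pts j is irrelevant where npts <= j. *)
Record point_process d (T : measurableType d) (R : realType) := PointProcess {
  npts : {mfun T >-> nat} ;
  pts : nat -> {mfun T >-> R} }.

Section PointProcess.
Context d (T : measurableType d) (R : realType).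
Implicit Types Z : point_process T R.

Definition pp_measure Z (w : T) (B : set R) : \bar R :=
  (\sum_(j < npts Z w) \d_(pts Z j w) B)%E.

(* With B = setT the generators also determine npts Z. *)
Definition pp_sigma Z : set_system T :=
  <<s [set A | exists j (B : set R), measurable B /\
         A = [set w | (j < npts Z w)%N /\ B (pts Z j w)]] >>.

Variables (P : probability T R) (Z : point_process T R).

Definition moment_gen (theta : R) : \bar R :=
  'E_P[fun w => \sum_(j < npts Z w) expR (theta * pts Z j w)].

Definition log_moment_gen (theta : R) : R := ln (fine (moment_gen theta)).

(* ereal_inf set0 = +oo. *)
Definition theta0 : \bar R :=
  ereal_inf [set theta%:E | theta in
    [set t : R | 0 < t /\ log_moment_gen t / t = derive1 log_moment_gen t]].

End PointProcess.

(* Equality in law as random measures: the counts of finitely many Borel sets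
   have the same joint distribution. *)
Definition pp_same_law (R : realType)
    d (T : measurableType d) (P : probability T R) (Z : point_process T R)
    d' (T' : measurableType d') (P' : probability T' R)
    (Z' : point_process T' R) : Prop :=
  forall (k : nat) (B : 'I_k -> set R) (c : 'I_k -> \bar R),
    (forall i, measurable (B i)) ->
    P [set w | forall i, pp_measure Z w (B i) = c i] =
    P' [set w | forall i, pp_measure Z' w (B i) = c i].

(* Particles carry Ulam-Harris labels, most recent birth index first:
   j :: u is the child of u numbered j, [::] is the root and the generation of
   v is size v.  X u is the displacement process of the offspring of u; it is
   given for all words u, including those that are not born. *)
Section BranchingRandomWalk.
Context d (T : measurableType d) (R : realType).
Variable X : seq nat -> point_process T R.

Fixpoint generation (n : nat) (w : T) : seq (seq nat) :=
  if n is n'.+1 then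
    [seq j :: u | u <- generation n' w, j <- iota 0 (npts (X u) w)]
  else [:: [::]].

Fixpoint position (v : seq nat) (w : T) : R :=
  if v is j :: u then position u w + pts (X u) j w else 0.

(* Sigma-algebra generated by the family of positions S(u), |u| <= n, indexed
   by the random set of particles alive. *)
Definition brw_sigma (n : nat) : set_system T :=
  <<s [set A | exists u (B : set R), [/\ (size u <= n)%N, measurable B &
         A = [set w | u \in generation (size u) w /\ B (position u w)]]] >>.

Definition is_brw (P : probability T R) d0 (T0 : measurableType d0)
    (P0 : probability T0 R) (Z : point_process T0 R) : Prop :=
  mutually_independent P (fun u => pp_sigma (X u)) /\
  forall u, pp_same_law P (X u) P0 Z.

Variables Y E : seq nat -> {mfun T >-> R}.

(* The marks Y v, E v for |v| = n >= 1; as above they are given for all words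
   of length n. *)
Definition is_modification (P : probability T R)
    (mu : set R -> \bar R) : Prop :=
  forall n, (0 < n)%N ->
    [/\ forall v : n.-tuple nat, forall A : set R, measurable A ->
          P (Y v @^-1` A) = mu A,
        forall v : n.-tuple nat, forall A : set R, measurable A ->
          P (E v @^-1` A) = exponential_prob 1 A &
        mutually_independent P
          (fun i : option (n.-tuple nat + n.-tuple nat) =>
             match i with
             | None => brw_sigma n
             | Some (inl v) => preimage_set_system setT (Y v) measurable
             | Some (inr v) => preimage_set_system setT (E v) measurable
             end)].

Definition lpm_max (theta : R) (n : nat) (w : T) : \bar R :=
  (\big[maxe/-oo]_(v <- generation n w)
     ((position v w)%:E +
      (theta^-1)%:E * (lne (Y v w)%:E - lne (E v w)%:E)))%E.

End BranchingRandomWalk.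

(* Main.v *)
(* Conditionally on the positions, the scaled maximum is at most x iff
   E_v >= a_v Y_v for all |v| = n, where a_v = exp (theta (S(v) - x) - n nu);
   so its distribution function at x is E prod_v psi(a_v), psi being the
   Laplace transform of mu.  By the branching property this is
   (Gamma^n psi)(exp (- theta x)) for the smoothing transform
     Gamma f(t) = E prod_(j < N) f(t A_j),  A_j = exp (theta xi_j - nu),
   an operator that only involves the law of Z.  Moreover E sum A_j = 1 and,
   as theta < theta0, kappa := E sum A_j^q < 1 for some 1 < q <= 2, so a bound
   |f - g|(s) <= a s + b s^q improves to a s + b kappa^n s^q after n steps.
   As psi(s) = exp (- <mu> s) + o(s), Gamma^n psi(t) has the same limit as
   Gamma^n applied to exp (- <mu> s), that is phi(<mu> t), where phi is the
   increasing limit of the iterates of exp (- s).  Finally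
   x |-> phi(exp (- theta x)) is the distribution function of H. *)

Require Import Defs.
From HB Require Import structures.
From mathcomp Require Import all_boot all_order all_algebra finmap.
From mathcomp Require Import all_classical all_reals all_analysis.
From mathcomp Require Import measurable_realfun.
From mathcomp Require Import ring lra.

Set Implicit Arguments.
Unset Strict Implicit.
Unset Printing Implicit Defensive.

Import Order.TTheory GRing.Theory Num.Theory.
Import numFieldNormedType.Exports.

Local Open Scope classical_set_scope.
Local Open Scope ring_scope.

(** * Integrals of random products *)

(** The classical route takes the limit [W] of the additive martingale. Here only functions on the
    half line are iterated: [phi] is the Laplace transform of [W], and [H] has the law of
    [(ln W - ln E) / theta] with [E] exponential and independent of [W]. Three obstacles shape the
    proof. The iteration reproduces linear errors undamped, so the error must be split into a linear
    part that is small from the start and a part of order [q] that contracts. The limit [phi] might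
    be identically [1]; an invariant bound [1 - t + C t^q] rules this out, at the price of
    [E (sum A_j)^q < oo], which combines the moment of [N] with the exponential moments of all
    positive orders. Finally, independence speaks of deterministic finite families, whereas a
    generation is random: an unborn word gets weight [0], where all functions involved equal [1], so
    a product over a generation is the limit of products over the first [K] words. *)

Lemma ler_norm_prodB (R : numDomainType) (I : Type) (s : seq I) (a b : I -> R) :
  (forall i, 0 <= a i <= 1) -> (forall i, 0 <= b i <= 1) ->
  `|\prod_(i <- s) a i - \prod_(i <- s) b i| <= \sum_(i <- s) `|a i - b i|.
Proof.
move=> ha hb; elim: s => [|i s IH]; first by rewrite !big_nil subrr normr0.
rewrite !big_cons.
have -> : a i * \prod_(j <- s) a j - b i * \prod_(j <- s) b j =
  (a i - b i) * \prod_(j <- s) a j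
  + b i * (\prod_(j <- s) a j - \prod_(j <- s) b j) by ring.
apply: (le_trans (ler_normD _ _)); rewrite !normrM lerD//.
  rewrite ler_piMr// ger0_norm ?prodr_ge0// => [|j _].
    by apply: prodr_ile1 => j; rewrite ha.
  by case/andP: (ha j).
case/andP: (hb i) => b0 b1.
by rewrite (le_trans _ IH)// ger0_norm// ler_piMl.
Qed.

Section Rintegral_probability.
Context d (T : measurableType d) (R : realType) (P : probability T R).
Implicit Types f g h : T -> R.

Lemma integrable_unit f : measurable_fun setT f ->
  (forall w, 0 <= f w <= 1) -> P.-integrable setT (EFin \o f).
Proof.
move=> mf hf; apply: (@le_integrable _ _ _ P _ measurableT _ (cst 1%E)) => //.
- exact/measurable_EFinP.
- move=> w _ /=; case/andP: (hf w) => f0 f1.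
  by rewrite lee_fin !ger0_norm.
- exact: finite_measure_integrable_cst.
Qed.

Lemma Rintegral_unit f : measurable_fun setT f ->
  (forall w, 0 <= f w <= 1) -> 0 <= \int[P]_w f w <= 1.
Proof.
move=> mf hf; apply/andP; split.
  by apply: Rintegral_ge0 => w _; case/andP: (hf w).
have -> : 1 = \int[P]_w (cst (1:R) w).
  rewrite Rintegral_cst// mul1r [X in fine X](_ : _ = 1%E) //.
  exact: probability_setT.
apply: le_Rintegral => //; first exact: integrable_unit.
  exact: finite_measure_integrable_cst.
by move=> w _; case/andP: (hf w).
Qed.

Lemma bounded_convergence (f_ : (T -> R)^nat) f :
  (forall n, measurable_fun setT (f_ n)) ->
  (forall n w, 0 <= f_ n w <= 1) ->
  (forall w, f_ ^~ w @ \oo --> f w) ->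
  (\int[P]_w f_ n w) @[n --> \oo] --> \int[P]_w f w.
Proof.
move=> mf_ f01 ff.
have mf : measurable_fun setT f.
  by apply: measurable_fun_cvg mf_ _ => w _; exact: ff.
have [||||| fi _ cf] := @dominated_convergence _ _ _ P setT measurableT
   (fun n => EFin \o f_ n) (EFin \o f) (cst 1%E).
- by move=> n; exact/measurable_EFinP.
- exact/measurable_EFinP.
- apply: aeW => w _; apply/fine_cvgP; split; first exact: nearW.
  exact: ff.
- exact: finite_measure_integrable_cst.
- apply: aeW => w n _ /=; case/andP: (f01 n w) => f0 f1.
  by rewrite lee_fin ger0_norm.
apply: fine_cvg; rewrite fineK; first exact: cf.
exact: integrable_fin_num.
Qed.

Lemma Rintegral_cst1 (r : R) : \int[P]_w r = r.
Proof.
have := @Rintegral_cst _ _ _ P setT measurableT r.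
rewrite [X in fine X](_ : _ = 1%E) ?mulr1//.
exact: probability_setT.
Qed.

Lemma ler_norm_RintegralB f g h : P.-integrable setT (EFin \o f) ->
  P.-integrable setT (EFin \o g) -> P.-integrable setT (EFin \o h) ->
  (forall w, `|f w - g w| <= h w) ->
  `|\int[P]_w f w - \int[P]_w g w| <= \int[P]_w h w.
Proof.
move=> fi gi hi fgh; rewrite -RintegralB//.
have fgi : P.-integrable setT (EFin \o (f \- g)).
  rewrite (_ : _ \o _ = (EFin \o f) \- (EFin \o g))%E; last by [].
  exact: integrableB.
apply: (le_trans (le_normr_Rintegral _ fgi)) => //.
by apply: le_Rintegral => // [|w _]; [exact: integrable_norm|exact: fgh].
Qed.

End Rintegral_probability.

Section nat_indexed.
Context d (T : measurableType d) (R : realType).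

Lemma measurable_fun_nat_index d' (T' : measurableType d') (N : T -> nat)
    (G : nat -> T -> T') : measurable_fun setT N ->
  (forall k, measurable_fun setT (G k)) ->
  measurable_fun setT (fun w => G (N w) w).
Proof.
move=> mN mG _ B mB; rewrite setTI.
have -> : (fun w => G (N w) w) @^-1` B =
    \bigcup_k (N @^-1` [set k] `&` (G k) @^-1` B).
  by apply/seteqP; split => [w /= Bw|w [k _ [/= <-]]//]; exists (N w).
apply: bigcup_measurable => k _; apply: measurableI.
  by rewrite -[X in measurable X]setTI; exact: mN.
by rewrite -[X in measurable X]setTI; exact: mG.
Qed.

Lemma measurable_random_sum (N : T -> nat) (g : nat -> T -> R) :
  measurable_fun setT N -> (forall j, measurable_fun setT (g j)) ->
  measurable_fun setT (fun w => \sum_(j < N w) g j w).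
Proof.
move=> mN mg; apply: (measurable_fun_nat_index (G := fun k w => \sum_(j < k) g j
  w)) => // k.
by apply: measurable_sum => j.
Qed.

Lemma measurable_random_prod (N : T -> nat) (g : nat -> T -> R) :
  measurable_fun setT N -> (forall j, measurable_fun setT (g j)) ->
  measurable_fun setT (fun w => \prod_(j < N w) g j w).
Proof.
move=> mN mg; apply: (measurable_fun_nat_index (G := fun k w => \prod_(j < k) g j
  w)) => // k.
by apply: measurable_prod => j _.
Qed.

End nat_indexed.

(** * The smoothing transform *)

(** A second-order bound weakened to order [q], the order of the moments at hand. For [x >= 1]
    already [x <= x ^ q]; for [x < 1] the quadratic bound suffices since [x ^ 2 <= x ^ q]. *)
Lemma expRN_le_powR (R : realType) (q x : R) : 1 < q <= 2 -> 0 <= x ->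
  expR (- x) <= 1 - x + x `^ q.
Proof.
move=> /andP[q1 q2] x0; have [x1|x1] := leP 1 x.
  have h1 : expR (- x) <= 1 by rewrite expR_le1; lra.
  have h2 : x <= x `^ q := le1r_powR x1 (ltW q1).
  by lra.
have e1 : expR (- x) <= 1 - x + x ^+ 2.
  (* [(1 + x) (1 - x + x^2) = 1 + x^3 >= 1], so [1 / (1 - x + x^2) <= 1 + x <= expR x]. *)
  rewrite expRN invf_ple ?posrE ?expR_gt0//; last by nra.
  apply: le_trans (expR_ge1Dx x).
  rewrite -[leLHS]mul1r ler_pdivrMr; last by nra.
  have : 0 <= x ^+ 3 by exact: exprn_ge0.
  by nra.
suff : x ^+ 2 <= x `^ q by lra.
have [->|xn0] := eqVneq x 0; first by rewrite expr2 mulr0 powR_ge0.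
rewrite -powR_mulrn// -[X in _ `^ X](subrK q) powRD; last by rewrite xn0 implybT.
rewrite ler_piMl ?powR_ge0//.
have := @ge0_ler_powR R (2%:R - q) _ x 1.
by rewrite powR1; apply; rewrite ?nnegrE// ?subr_ge0//; lra.
Qed.

(** If [a <= b] the bound [u <= 1] suffices; otherwise expand at [a - b], which lies between [0] and
    [a]. The point is that [b] enters only linearly: it will be a random sum of which only the mean
    is controlled. *)
Lemma le1_expRB_powR (R : realType) (q u a b : R) : 1 < q <= 2 ->
  0 <= a -> 0 <= b -> u <= 1 -> u <= expR (b - a) -> u <= 1 - a + b + a `^ q.
Proof.
move=> hq a0 b0 u1 uba; have := powR_ge0 a q => aq.
have [ab|ab] := leP a b; first lra.
apply: (le_trans uba); rewrite -opprB.
have ab0 : 0 <= a - b by lra.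
apply: (le_trans (expRN_le_powR hq ab0)).
have : (a - b) `^ q <= a `^ q.
  by case/andP: hq => q1 q2; apply: ge0_ler_powR; rewrite ?nnegrE//; lra.
lra.
Qed.

Lemma lipschitz_measurable (R : realType) (L : R) (f : R -> R) :
  (forall x y, `|f x - f y| <= L * `|x - y|) -> measurable_fun setT f.
Proof.
move=> fL; apply: continuous_measurable_fun => x.
apply/cvgrPdist_le => e e0; near=> y.
apply: (le_trans (fL _ _)).
have : `|x - y| <= e / (`|L| + 1).
  near: y; have := @cvg_id _ (nbhs x); move/cvgrPdist_le; apply.
  by rewrite divr_gt0// ltr_wpDl.
rewrite ler_pdivlMr ?ltr_wpDl// => h.
have := ler_norm L; have := normr_ge0 (x - y); nra.
Unshelve. all: by end_near. Qed.

Section isint.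
Context d (T : measurableType d) (R : realType) (P : probability T R).
Implicit Types f g : T -> R.

(** Integrability and value travel together, so that the integral of a linear combination is
    obtained by composing terms. *)
Definition isint f (v : R) :=
  P.-integrable setT (EFin \o f) /\ \int[P]_w f w = v.

Lemma isint_cst (r : R) : isint (fun=> r) r.
Proof.
by split; [exact: finite_measure_integrable_cst|exact: Rintegral_cst1].
Qed.

Lemma isint_unit f : measurable_fun setT f -> (forall w, 0 <= f w <= 1) ->
  isint f (\int[P]_w f w).
Proof. by move=> mf f01; split => //; exact: integrable_unit. Qed.

Lemma isintD f g u v : isint f u -> isint g v ->
  isint (fun w => f w + g w) (u + v).
Proof.
move=> [fi <-] [gi <-]; split; last by rewrite RintegralD.
rewrite (_ : _ \o _ = (EFin \o f) \+ (EFin \o g))%E; last by [].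
exact: integrableD.
Qed.

Lemma isintZ f u (r : R) : isint f u -> isint (fun w => r * f w) (r * u).
Proof.
move=> [fi <-]; split; last by rewrite RintegralZl.
rewrite (_ : _ \o _ = fun w => r%:E * (EFin \o f) w)%E; last by [].
exact: integrableZl.
Qed.

Lemma isint_le f g u v : isint f u -> isint g v -> (forall w, f w <= g w) ->
  u <= v.
Proof. by move=> [fi <-] [gi <-] fg; apply: le_Rintegral. Qed.

Lemma isint_dist f g h u v x : isint f u -> isint g v -> isint h x ->
  (forall w, `|f w - g w| <= h w) -> `|u - v| <= x.
Proof. by move=> [? <-] [? <-] [? <-]; exact: ler_norm_RintegralB. Qed.

Lemma isint_indic (B : set T) : measurable B -> isint \1_B (fine (P B)).
Proof.
move=> mB; split; first exact: integrable_indic.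
by rewrite /Rintegral integral_indic// setIT.
Qed.

Lemma isint_eq f g u : isint f u -> f =1 g -> isint g u.
Proof. by move=> fu /funext <-. Qed.

End isint.

Section smoothing_transform.
Context d (T : measurableType d) (R : realType) (P : probability T R).
Variables (N : T -> nat) (A : nat -> T -> R).
Hypotheses (mN : measurable_fun setT N) (mA : forall j, measurable_fun setT (A j)).
Hypothesis A_gt0 : forall j w, 0 < A j w.

Let A_ge0 j w : 0 <= A j w := ltW (A_gt0 j w).

Definition smooth (f : R -> R) (t : R) : R :=
  \int[P]_w \prod_(j < N w) f (t * A j w).

(** The class in which the iteration takes place. Being Lipschitz gives measurability, and [smooth]
    keeps the constant [L] because the weights have mean total [1]. *)
Definition unit_lip (L : R) (f : R -> R) :=
  (forall t, 0 <= f t <= 1) /\ (forall x y, `|f x - f y| <= L * `|x - y|).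

Lemma unit_lip_measurable L f : unit_lip L f -> measurable_fun setT f.
Proof. by case=> _; exact: lipschitz_measurable. Qed.

Lemma prod_unit (f : R -> R) t w : (forall t, 0 <= f t <= 1) ->
  0 <= \prod_(j < N w) f (t * A j w) <= 1.
Proof.
move=> f01; rewrite prodr_ge0/= => [|j _]; last by case/andP: (f01 (t * A j w)).
by apply: prodr_ile1 => j; rewrite f01.
Qed.

Lemma measurable_prod_smooth (f : R -> R) t : measurable_fun setT f ->
  measurable_fun setT (fun w => \prod_(j < N w) f (t * A j w)).
Proof.
move=> mf; apply: (measurable_random_prod (g := fun j w => f (t * A j w))) => // j.
by apply: measurableT_comp => //; exact: measurable_funM.
Qed.

Lemma isint_smooth L f t : unit_lip L f ->
  isint P (fun w => \prod_(j < N w) f (t * A j w)) (smooth f t).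
Proof.
move=> fL; apply: isint_unit.
  by apply: measurable_prod_smooth; exact: unit_lip_measurable fL.
by move=> w; apply: prod_unit; case: fL.
Qed.

Lemma smooth_cvg L (f_ : (R -> R)^nat) f t : (forall n, unit_lip L (f_ n)) ->
  (forall s, f_ ^~ s @ \oo --> f s) ->
  (smooth (f_ n) t) @[n --> \oo] --> smooth f t.
Proof.
move=> fL ff; apply: bounded_convergence.
- by move=> n; apply: measurable_prod_smooth; exact: unit_lip_measurable (fL n).
- by move=> n w; apply: prod_unit; case: (fL n).
- by move=> w; apply: cvg_big => [|i _]; [exact: mul_continuous|exact: ff].
Qed.

Lemma smooth_mono L L' f g t s : unit_lip L f -> unit_lip L' g ->
  (forall a, 0 <= a -> f (t * a) <= g (s * a)) -> smooth f t <= smooth g s.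
Proof.
move=> fL gL fg; apply: isint_le (isint_smooth _ fL) (isint_smooth _ gL) _ => w.
apply: ler_prod => j _; rewrite fg// andbT.
by case: fL => f01 _; case/andP: (f01 (t * A j w)).
Qed.


Variables (q kappa M : R).
Hypothesis q12 : 1 < q <= 2.
Hypothesis sumA : isint P (fun w => \sum_(j < N w) A j w) 1.
Hypothesis sumAq : isint P (fun w => \sum_(j < N w) A j w `^ q) kappa.
Hypothesis sumA_q : isint P (fun w => (\sum_(j < N w) A j w) `^ q) M.
Hypothesis kappa_lt1 : kappa < 1.

Lemma sum_powR_mean_ge0 : 0 <= kappa.
Proof.
apply: isint_le (isint_cst _ 0) sumAq _ => w.
by apply: sumr_ge0 => j _; exact: powR_ge0.
Qed.

Lemma total_powR_mean_ge0 : 0 <= M.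
Proof. by apply: isint_le (isint_cst _ 0) sumA_q _ => w; exact: powR_ge0. Qed.

(** The difference of two products is at most the sum of the differences of the factors, so the
    bound at [a = A j w] is summed over the children and averaged. Two arguments [t] and [s] let one
    statement serve both the Lipschitz bound ([be = 0]) and the contraction ([s = t]). *)
Lemma smooth_dist L L' f g t s (al be : R) : unit_lip L f -> unit_lip L' g ->
  (forall a, 0 <= a -> `|f (t * a) - g (s * a)| <= al * a + be * a `^ q) ->
  `|smooth f t - smooth g s| <= al + be * kappa.
Proof.
move=> fL gL fg; rewrite -[al]mulr1.
apply: isint_dist (isint_smooth _ fL) (isint_smooth _ gL)
  (isintD (isintZ al sumA) (isintZ be sumAq)) _ => w.
apply: le_trans (ler_norm_prodB _ _ _) _.
- by move=> j; case: fL.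
- by move=> j; case: gL.
- rewrite !big_distrr -big_split /=.
  by apply: ler_sum => j _; exact: fg.
Qed.

Lemma smooth_lip L f : unit_lip L f -> unit_lip L (smooth f).
Proof.
move=> fL; split => [t|x y].
  apply: Rintegral_unit.
    by apply: measurable_prod_smooth; exact: unit_lip_measurable fL.
  by move=> w; apply: prod_unit; case: fL.
have := smooth_dist (al := L * `|x - y|) (be := 0) (t := x) (s := y) fL fL.
rewrite mul0r addr0; apply=> a a0; rewrite mul0r addr0.
case: fL => _ /(_ (x * a) (y * a)) /le_trans; apply.
by rewrite -mulrBl normrM (ger0_norm a0) mulrA.
Qed.

Lemma iter_smooth_lip n L f : unit_lip L f -> unit_lip L (iter n smooth f).
Proof. by move=> fL; elim: n => //= n; exact: smooth_lip. Qed.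

Lemma iter_smooth_dist n L L' f g (al be : R) : unit_lip L f -> unit_lip L' g ->
  (forall s, 0 <= s -> `|f s - g s| <= al * s + be * s `^ q) ->
  forall s, 0 <= s ->
    `|iter n smooth f s - iter n smooth g s| <= al * s + be * kappa ^+ n * s `^ q.
Proof.
move=> fL gL fg; elim: n => [|n IH] s s0; first by rewrite expr0 mulr1; exact: fg.
rewrite /=; have := @smooth_dist L L' (iter n smooth f) (iter n smooth g) s s
  (al * s) (be * kappa ^+ n * s `^ q).
rewrite (_ : be * kappa ^+ n * s `^ q * kappa = be * kappa ^+ n.+1 * s `^ q);
  last by rewrite exprSr; ring.
apply.
- exact: iter_smooth_lip.
- exact: iter_smooth_lip.
- move=> a a0; apply: (le_trans (IH _ _)); first exact: mulr_ge0.
  by rewrite powRM// !mulrA.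
Qed.

(* Apply [le1_expRB_powR] under the integral with [a = t * sum A] and
   [b = C * t `^ q * sum A `^ q]; only [E (sum A) `^ q] is needed, no
   exponential moment. *)
Lemma smooth_subsolution L f (C : R) : unit_lip L f -> M + C * kappa <= C ->
  (forall x, 0 <= x -> f x <= 1 - x + C * x `^ q) ->
  forall t, 0 <= t -> smooth f t <= 1 - t + C * t `^ q.
Proof.
move=> fL MC fC t t0.
have C0 : 0 <= C.
  have := total_powR_mean_ge0; have := sum_powR_mean_ge0; have := kappa_lt1.
  by nra.
have tq : 0 <= t `^ q := powR_ge0 _ _.
suff : smooth f t <= (1 + (- t) * 1) + ((C * t `^ q) * kappa + t `^ q * M).
  by move=> /le_trans; apply; nra.
apply: isint_le (isint_smooth _ fL) (isintD
  (isintD (isint_cst _ 1) (isintZ (- t) sumA))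
  (isintD (isintZ (C * t `^ q) sumAq) (isintZ (t `^ q) sumA_q))) _ => w.
set W := \sum_(j < N w) A j w; set S := \sum_(j < N w) A j w `^ q.
have W0 : 0 <= W by exact: sumr_ge0.
have S0 : 0 <= S by apply: sumr_ge0 => j _; exact: powR_ge0.
have := @le1_expRB_powR R q (\prod_(j < N w) f (t * A j w)) (t * W)
  (C * t `^ q * S) q12.
rewrite powRM// mulNr !addrA => ->//; first exact: mulr_ge0.
- by rewrite !mulr_ge0.
- by have /andP[] := prod_unit t w (fL.1).
(* Each factor is at most some [1 + x <= expR x], so the product is at most the exponential of the
   sum. *)
rewrite addrC !big_distrr /= -sumrN -big_split /= expR_sum.
apply: ler_prod => j _; case/andP: (fL.1 (t * A j w)) => -> _ /=.
apply: (le_trans (fC _ _)); first exact: mulr_ge0.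
rewrite -addrA; apply: le_trans (expR_ge1Dx _).
by rewrite powRM// !mulrA.
Qed.

(** * The fixed point of the smoothing transform *)

Let e (t : R) := expR (- `|t|).

Lemma expRN_norm_lip (c : R) : 0 <= c -> unit_lip c (fun t => expR (- (c * `|t|))).
Proof.
move=> c0; split => [t|].
  by rewrite expR_ge0 expR_le1 oppr_le0 mulr_ge0.
have H (x y : R) : 0 <= x <= y -> `|expR (- (c * x)) - expR (- (c * y))| <= c * (y - x).
  move=> /andP[x0 xy].
  have -> : expR (- (c * y)) = expR (- (c * x)) * expR (- (c * (y - x))).
    by rewrite -expRD; congr expR; ring.
  have h1 := expR_ge1Dx (- (c * (y - x))).
  have h2 : expR (- (c * (y - x))) <= 1.
    by rewrite expR_le1 oppr_le0 mulr_ge0// subr_ge0.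
  have h3 : expR (- (c * x)) <= 1 by rewrite expR_le1 oppr_le0 mulr_ge0.
  have h4 := expR_ge0 (- (c * x)).
  have cc : 0 <= c * (y - x) by rewrite mulr_ge0// subr_ge0.
  by rewrite ger0_norm; nra.
move=> x y; have [xy|/ltW xy] := leP `|x| `|y|.
  apply: le_trans (H _ _ _) _; first by rewrite normr_ge0.
  rewrite ler_wpM2l// distrC.
  by have := ler_dist_dist y x; rewrite ger0_norm ?subr_ge0.
rewrite distrC; apply: le_trans (H _ _ _) _; first by rewrite normr_ge0.
rewrite ler_wpM2l//.
by have := ler_dist_dist x y; rewrite ger0_norm ?subr_ge0.
Qed.

Lemma expRN_norm_lip1 : unit_lip 1 e.
Proof.
have := expRN_norm_lip ler01; congr (unit_lip _ _).
by apply/funext => t; rewrite mul1r.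
Qed.

(** Jensen's inequality for [E expR (- |t| W)], where [W], the sum of the weights, has mean [1]:
    integrate the tangent of the exponential at the mean. *)
Lemma smooth_e_ge t : e t <= smooth e t.
Proof.
have -> : e t = e t * (1 + `|t|) + (- (e t * `|t|)) * 1 by ring.
apply: isint_le (isintD (isint_cst _ _) (isintZ _ sumA)) (isint_smooth t
  expRN_norm_lip1) _ => w.
rewrite -expR_sum.
have -> : \sum_(j < N w) (- `|t * A j w|) = - (`|t| * \sum_(j < N w) A j w).
  rewrite sumrN big_distrr/=; congr (- _); apply: eq_bigr => j _.
  by rewrite normrM (ger0_norm (A_ge0 _ _)).
set W := \sum_(j < N w) A j w.
have -> : - (`|t| * W) = - `|t| + (`|t| - `|t| * W) by ring.
rewrite expRD -/(e t).
have := expR_ge1Dx (`|t| - `|t| * W); have := expR_ge0 (- `|t|); rewrite -/(e t).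
nra.
Qed.

Lemma iter_smooth_e_nondecreasing t :
  {homo (fun n => iter n smooth e t) : n m / (n <= m)%N >-> n <= m}.
Proof.
apply/nondecreasing_seqP => n; elim: n t => [|n IH] t; first exact: smooth_e_ge.
apply: smooth_mono (iter_smooth_lip n expRN_norm_lip1) (iter_smooth_lip n.+1
  expRN_norm_lip1) _ => a _.
exact: IH.
Qed.

(** For [t >= 0] the [n]-th iterate is the Laplace transform of the total weight of generation [n],
    the additive martingale; the limit is thus the Laplace transform of the martingale limit. *)
Definition smooth_fix (t : R) : R := limn (fun n => iter n smooth e t).
Notation phi := smooth_fix.

Lemma smooth_fix_cvg t : iter n smooth e t @[n --> \oo] --> phi t.
Proof.
apply: nondecreasing_is_cvgn; first exact: iter_smooth_e_nondecreasing.
exists 1 => _ [n _ <-].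
by case: (iter_smooth_lip n expRN_norm_lip1) => /(_ t) /andP[].
Qed.

Lemma smooth_fix_lip : unit_lip 1 phi.
Proof.
split => [t|x y].
  apply/andP; split.
    apply: limr_ge; first by apply/cvg_ex; eexists; exact: smooth_fix_cvg.
    by apply: nearW => n; case: (iter_smooth_lip n expRN_norm_lip1) => /(_ t) /andP[].
  apply: limr_le; first by apply/cvg_ex; eexists; exact: smooth_fix_cvg.
  by apply: nearW => n; case: (iter_smooth_lip n expRN_norm_lip1) => /(_ t) /andP[].
have c : `|iter n smooth e x - iter n smooth e y| @[n --> \oo] --> `|phi x - phi y|.
  by apply: cvg_norm; apply: cvgB; exact: smooth_fix_cvg.
apply: (cvgr_to_le c); apply: nearW => n.
by case: (iter_smooth_lip n expRN_norm_lip1) => _ /(_ x y).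
Qed.

(** This forces [phi] to tend to [1] at [0], hence the limiting distribution function to tend to [1]
    at [+oo]. *)
Lemma smooth_fix_ge t : e t <= phi t.
Proof.
apply: (cvgr_to_ge (@smooth_fix_cvg t)); apply: nearW => n.
exact: (@iter_smooth_e_nondecreasing t 0%N n).
Qed.

Lemma smooth_fixE t : smooth phi t = phi t.
Proof.
have c1 : smooth (iter n smooth e) t @[n --> \oo] --> smooth phi t.
  by apply: smooth_cvg (fun n => iter_smooth_lip n expRN_norm_lip1) _ => s;
    exact: smooth_fix_cvg.
have c2 : iter n.+1 smooth e t @[n --> \oo] --> phi t.
  by have := @smooth_fix_cvg t; rewrite -cvg_shiftS.
exact: cvg_unique c1 c2.
Qed.

Lemma smooth_fix_nonincreasing s t : 0 <= s <= t -> phi t <= phi s.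
Proof.
move=> st; apply: ler_cvg_to (@smooth_fix_cvg t) (@smooth_fix_cvg s) _.
apply: nearW => n; elim: n s t st => [|n IH] s t /andP[s0 st].
  by rewrite /= /e ler_expR lerN2 !ger0_norm// (le_trans s0).
apply: smooth_mono (iter_smooth_lip n expRN_norm_lip1) (iter_smooth_lip n
  expRN_norm_lip1) _ => a a0.
by apply: IH; rewrite mulr_ge0// ler_wpM2r.
Qed.

(* All iterates stay below [1 - t + C t `^ q]; this replaces the uniform
   integrability of the additive martingale. *)
Lemma smooth_fix_nontrivial : exists2 t, 0 < t & phi t < 1.
Proof.
(* [M / (1 - kappa)] solves [M + C * kappa = C]; adding [1] keeps [M + C * kappa <= C] and makes the
   bound hold for [e] itself, which needs [C >= 1]. *)
pose C := 1 + M / (1 - kappa).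
have k0 := sum_powR_mean_ge0; have M0 := total_powR_mean_ge0.
have k1 : 0 < 1 - kappa by rewrite subr_gt0.
have C1 : 1 <= C by rewrite lerDl divr_ge0// ltW.
have MC : M + C * kappa <= C.
  have : M / (1 - kappa) * (1 - kappa) = M by rewrite divfK// gt_eqF.
  by rewrite /C; nra.
have phiC t : 0 <= t -> phi t <= 1 - t + C * t `^ q.
  move=> t0; apply: (cvgr_to_le (@smooth_fix_cvg t)); apply: nearW => n.
  elim: n t t0 => [|n IH] t t0.
    rewrite /= /e ger0_norm//; apply: (le_trans (expRN_le_powR q12 t0)).
    by have := powR_ge0 t q => tq; nra.
  exact: smooth_subsolution (iter_smooth_lip n expRN_norm_lip1) MC IH t t0.
have C0 : 0 < 2 * C by lra.
case/andP: q12 => q1 q2.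
(* Chosen so that [C * t ^ q = t / 2]; the bound becomes [1 - t / 2]. *)
pose t := (2 * C) `^ (- (q - 1)^-1).
have t0 : 0 < t by exact: powR_gt0.
exists t => //; apply: (le_lt_trans (phiC t (ltW t0))).
have -> : t `^ q = t * (2 * C)^-1.
  have -> : q = 1 + (q - 1) by ring.
  rewrite powRD; last by rewrite (gt_eqF t0) implybT.
  rewrite powRr1 ?ltW//; congr (_ * _).
  rewrite /t -powRrM mulNr mulVf; last by rewrite gt_eqF// subr_gt0.
  by rewrite powR_inv1// ltW.
have -> : C * (t * (2 * C)^-1) = t / 2.
  by field; rewrite gt_eqF// (lt_le_trans ltr01 C1).
lra.
Qed.

(** Scaling the argument commutes with the transform, so an exponential of any rate [c] has its
    iterates controlled by those of [e]. *)
Lemma iter_smooth_scale (f : R -> R) (c : R) n t :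
  iter n smooth (fun x => f (c * x)) t = iter n smooth f (c * t).
Proof.
elim: n t => // n IH t; rewrite /= /smooth.
by apply: eq_Rintegral => w _; apply: eq_bigr => j _; rewrite IH mulrA.
Qed.

(** The linear error is not damped by iteration, so [eta] is fixed first, in terms of [t] and [eps].
    The resulting [B] may be huge, but it is multiplied by [kappa ^ n]. *)
Lemma iter_smooth_cvg L (psi : R -> R) (c : R) : unit_lip L psi -> 0 <= c ->
  (forall eta, 0 < eta -> exists2 B, 0 <= B & forall s, 0 <= s ->
    `|psi s - expR (- (c * s))| <= eta * s + B * s `^ q) ->
  forall t, 0 <= t -> iter n smooth psi t @[n --> \oo] --> phi (c * t).
Proof.
move=> psiL c0 psiB t t0; apply/cvgrPdist_le => eps eps0.
(* With [eta = eps / 3 / (t + 1)] the linear term [eta * t] is at most [eps / 3]; the [+ 1] covers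
   [t = 0]. *)
have eta0 : 0 < eps / 3 / (t + 1) by rewrite !divr_gt0// ltr_wpDl.
have [B B0 HB] := psiB _ eta0.
have ce : (fun x => e (c * x)) = fun x => expR (- (c * `|x|)).
  by apply/funext => x; rewrite /e normrM (ger0_norm c0).
have D n : `|iter n smooth psi t - iter n smooth e (c * t)| <=
    eps / 3 + B * kappa ^+ n * t `^ q.
  rewrite -iter_smooth_scale ce.
  apply: le_trans (iter_smooth_dist n psiL (expRN_norm_lip c0) _ t0) _.
    by move=> s s0; rewrite (ger0_norm s0); exact: HB.
  rewrite lerD2r mulrAC -mulrA ler_piMr//; first by rewrite ltW// divr_gt0.
  by rewrite ler_pdivrMr ?ltr_wpDl// mul1r lerDl.
have kc : B * kappa ^+ n * t `^ q @[n --> \oo] --> 0.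
  rewrite -[X in _ --> X](mul0r (t `^ q)); apply: cvgMl.
  rewrite -[X in _ --> X](mulr0 B); apply: cvgMr.
  by apply: cvg_expr; rewrite ger0_norm ?sum_powR_mean_ge0.
near=> n.
have h1 : `|phi (c * t) - iter n smooth e (c * t)| <= eps / 3.
  near: n; have /cvgrPdist_le := @smooth_fix_cvg (c * t); apply; lra.
have h2 : B * kappa ^+ n * t `^ q <= eps / 3.
  apply: le_trans (ler_norm _) _; rewrite -normrN -[X in `|X|]sub0r.
  by near: n; move/cvgrPdist_le: kc; apply; lra.
have := D n => h3; rewrite distrC in h3.
have := ler_distD (iter n smooth e (c * t)) (phi (c * t)) (iter n smooth psi t).
lra.
Unshelve. all: by end_near. Qed.

(** * The fixed point vanishes at infinity *)

Hypothesis N_gt0 : P [set w | (1 <= N w)%N] = 1%E.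
Hypothesis N_neq1 : (P [set w | N w = 1%N] < 1)%E.

(* The limit [l] at infinity satisfies [l = E l ^+ N]. *)
Lemma smooth_fix_cvg0 : phi k%:R @[k --> \oo] --> 0.
Proof.
have mn : {homo (fun k : nat => phi k%:R) : n m / (n <= m)%N >-> m <= n}.
  by move=> n m nm; apply: smooth_fix_nonincreasing; rewrite ler0n ler_nat.
have [p01 _] := smooth_fix_lip.
have cv : cvgn (fun k : nat => phi k%:R).
  apply: nonincreasing_is_cvgn => //; exists 0 => _ [n _ <-].
  by case/andP: (p01 n%:R).
set l := limn (fun k : nat => phi k%:R) in cv *.
have cl : phi k%:R @[k --> \oo] --> l by exact: cv.
have l0 : 0 <= l by apply: (cvgr_to_ge cl); apply: nearW => n; case/andP: (p01 n%:R).
(* This excludes the root [1] of [l = E l ^ N]. *)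
have l1 : l < 1.
  have [t t0 ht] := smooth_fix_nontrivial.
  apply: le_lt_trans ht; apply: (cvgr_to_le cl); near=> n.
  apply: smooth_fix_nonincreasing; rewrite ltW//=.
  by near: n; exact: nbhs_infty_ger.
suff -> : 0 = l by exact: cl.
have lphi y : 0 <= y -> l <= phi y.
  move=> y0; apply: (cvgr_to_le cl); near=> n.
  apply: smooth_fix_nonincreasing; rewrite y0/=.
  by near: n; exact: nbhs_infty_ger.
(* All weights are positive, so every factor [phi (k * A j w)] has the same limit [l], and the
   product tends to [l ^ N w]. *)
have philx x : 0 < x -> phi (k%:R * x) @[k --> \oo] --> l.
  move=> x0; apply/cvgrPdist_le => eps eps0.
  have [m hm] : exists m : nat, phi m%:R <= l + eps.
    have /cvgrPdist_le /(_ _ eps0) [m _ hm] := cl; exists m.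
    by have := hm m (leqnn m); rewrite /= ler_norml; lra.
  near=> k.
  have h1 : l <= phi (k%:R * x) by apply: lphi; rewrite mulr_ge0// ltW.
  have h2 : phi (k%:R * x) <= phi m%:R.
    apply: smooth_fix_nonincreasing; rewrite ler0n/= -ler_pdivrMr//.
    by near: k; exact: nbhs_infty_ger.
  by rewrite ler_norml; lra.
have lN w : 0 <= l ^+ N w <= 1 by rewrite exprn_ge0//= exprn_ile1// ltW.
have mlN : measurable_fun setT (fun w => l ^+ N w).
  apply: (measurable_fun_nat_index (G := fun k _ => l ^+ k)) => // k.
have c1 : smooth phi k%:R @[k --> \oo] --> \int[P]_w (l ^+ N w).
  apply: bounded_convergence => //.
  - by move=> n; apply: measurable_prod_smooth; exact: unit_lip_measurable
      smooth_fix_lip.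
  - by move=> n w; apply: prod_unit.
  - move=> w; rewrite -[X in l ^+ X]card_ord -prodr_const.
    by apply: cvg_big => [|i _]; [exact: mul_continuous|exact: philx].
have {c1} lE : \int[P]_w (l ^+ N w) = l.
  apply: cvg_unique c1 _ => //.
  by rewrite (_ : (fun k => _) = fun k : nat => phi k%:R)//; apply/funext => k;
    exact: smooth_fixE.
have m1 : measurable [set w | N w = 1%N].
  by rewrite -[X in measurable X]setTI; exact: (mN measurableT (Y := [set 1%N])).
have mge1 : measurable [set w | (1 <= N w)%N].
  by rewrite -[X in measurable X]setTI; exact: (mN measurableT (Y := [set k | (1
    <= k)%N])).
(* The majorant of [l ^ N] equals [1] for [N = 0], [l] for [N = 1] and [l^2] for [N >= 2]. With
   [p1 = P (N = 1)] and [N >= 1] almost surely, taking means gives [l (1 - l) (1 - p1) <= 0], which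
   forces [l = 0]. *)
have := isint_le (isint_unit P mlN lN) (isintD (isintZ (l - l ^+ 2) (isint_indic P m1))
  (isintD (isint_cst P 1) (isintZ (l ^+ 2 - 1) (isint_indic P mge1)))).
rewrite lE N_gt0 /= => H.
have p1 : fine (P [set w | N w = 1%N]) < 1.
  by rewrite -lte_fin fineK ?fin_num_measure.
have {}H : l <= (l - l ^+ 2) * fine (P [set w | N w = 1%N]) + (1 + (l ^+ 2 - 1) * 1).
  apply: H => w; rewrite !indicE.
  have -> : (w \in [set w | N w = 1%N]) = (N w == 1%N).
    by apply/idP/eqP; rewrite inE.
  have -> : (w \in [set w | (1 <= N w)%N]) = (1 <= N w)%N.
    by apply/idP/idP; rewrite inE.
  case: (N w) => [|[|n]] /=; rewrite ?mulr0 ?mulr1 ?expr0 ?expr1 ?add0r ?addr0//.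
    lra.
  rewrite addrC subrK 2!exprSr -mulrA -expr2 ler_piMl ?exprn_ge0//.
  by rewrite exprn_ile1// ltW.
apply/eqP; rewrite eq_le l0 /= leNgt; apply/negP => lgt0.
have : 0 < l * (1 - l) * (1 - fine (P [set w | N w = 1%N])).
  by rewrite !mulr_gt0// subr_gt0.
by nra.
Unshelve. all: by end_near. Qed.

End smoothing_transform.

(** * Moment generating function and weights *)

(** Bound the sum by [n] times its largest term and apply Young's inequality with the conjugate
    exponents [(1 + p) / q] and [(1 + p) / (1 + p - q)]. This decouples the number of terms, which
    has a moment of order [1 + p], from their sizes. *)
Lemma sum_powR_le (R : realType) (p q : R) (n : nat) (a : nat -> R) :
  0 < q < 1 + p -> (forall j, 0 <= a j) ->
  (\sum_(j < n) a j) `^ q <=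
    n%:R `^ (1 + p) + \sum_(j < n) a j `^ (q * ((1 + p) / (1 + p - q))).
Proof.
move=> /andP[q0 qp] a0; case: n => [|n].
  by rewrite !big_ord0 powR0 ?gt_eqF// addr0 powR_ge0.
pose i0 := [arg max_(i > (ord0 : 'I_n.+1)) a i]%O.
have ai0 (i : 'I_n.+1) : a i <= a i0.
  by rewrite /i0; case: arg_maxP => //= i1 _; apply.
set rho := (1 + p) / (1 + p - q).
have pq : 0 < 1 + p - q by lra.
have p1 : 0 < 1 + p by lra.
have rho1 : 1 <= rho by rewrite ler_pdivlMr// mul1r; lra.
have pq1 : 1 <= (1 + p) / q by rewrite ler_pdivlMr// mul1r; lra.
have a_n : \sum_(j < n.+1) a j <= n.+1%:R * a i0.
  rewrite mulr_natl -[X in _ *+ X](card_ord n.+1) -sumr_const.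
  by apply: ler_sum => i _; exact: ai0.
have h1 : (\sum_(j < n.+1) a j) `^ q <= n.+1%:R `^ q * a i0 `^ q.
  rewrite -powRM//; apply: ge0_ler_powR; rewrite ?nnegrE ?(ltW q0)//.
    exact: sumr_ge0.
  by rewrite mulr_ge0.
apply: (le_trans h1).
apply: (le_trans (conjugate_powR (p := (1 + p) / q) (q := rho) _ _ _ _ _)).
- exact: powR_ge0.
- exact: powR_ge0.
- by rewrite divr_gt0.
- by rewrite divr_gt0.
- by rewrite /rho; field; rewrite !gt_eqF.
rewrite -!powRrM; have -> : q * ((1 + p) / q) = 1 + p by field; rewrite gt_eqF.
apply: lerD.
  rewrite ler_pdivrMr ?(lt_le_trans ltr01 pq1)// ler_peMr//; exact: powR_ge0.
apply: (@le_trans _ _ (a i0 `^ (q * rho))).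
  rewrite ler_pdivrMr ?(lt_le_trans ltr01 rho1)// ler_peMr//; exact: powR_ge0.
rewrite (bigD1 i0)//= lerDl; apply: sumr_ge0 => j _; exact: powR_ge0.
Qed.

Section log_moment_generating_function.
Context (R : realType) (d0 : measure_display) (T0 : measurableType d0)
  (P0 : probability T0 R) (Z : point_process T0 R).
Variable vartheta : R.
Hypothesis vartheta_gt0 : 0 < vartheta.
Hypothesis moment_gen_lty :
  forall t : R, - vartheta < t -> (moment_gen P0 Z t < +oo)%E.
Hypothesis npts_neq1 : (P0 [set w | npts Z w = 1%N] < 1)%E.
Hypothesis npts_gt0 : P0 [set w | (1 <= npts Z w)%N] = 1%E.

Let m t := fine (moment_gen P0 Z t).
Let nu := log_moment_gen P0 Z.
Let expsum t w := \sum_(j < npts Z w) expR (t * pts Z j w).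

Lemma measurable_expsum t : measurable_fun setT (expsum t).
Proof.
apply: (measurable_random_sum (g := fun j w => expR (t * pts Z j w))) => // j.
by apply: measurableT_comp => //; exact: measurable_funM.
Qed.

Lemma expsum_ge0 t w : 0 <= expsum t w.
Proof. by apply: sumr_ge0 => j _; exact: expR_ge0. Qed.

Lemma isint_expsum t : - vartheta < t -> isint P0 (expsum t) (m t).
Proof.
move=> /moment_gen_lty; rewrite /m /moment_gen unlock => h; split => //.
apply/integrableP; split; first exact/measurable_EFinP/measurable_expsum.
under eq_integral => w _ do rewrite gee0_abs ?lee_fin ?expsum_ge0//.
exact: h.
Qed.

Lemma measurable_npts_gt0 : measurable [set w | (1 <= npts Z w)%N].
Proof.
rewrite -[X in measurable X]setTI.
exact: (@measurable_funPT _ _ _ _ (npts Z) measurableT [set k | (1 <= k)%N]).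
Qed.

Lemma measurable_npts_eq1 : measurable [set w | npts Z w = 1%N].
Proof.
rewrite -[X in measurable X]setTI.
exact: (@measurable_funPT _ _ _ _ (npts Z) measurableT [set 1%N]).
Qed.

(** A vanishing mean would make the sum zero almost everywhere, although it is positive as soon as
    there is a point. Positivity lets [ln] be inverted and differentiated at [m t]. *)
Lemma moment_gen_gt0 t : - vartheta < t -> 0 < m t.
Proof.
move=> ht; have [mi mE] := isint_expsum ht.
have m0 : 0 <= m t by rewrite -mE; apply: Rintegral_ge0 => w _; exact: expsum_ge0.
rewrite lt_neqAle m0 andbT; apply/eqP => m0'.
have : (\int[P0]_w `|(expsum t w)%:E|)%E = 0%E.
  under eq_integral => w _ do rewrite gee0_abs ?lee_fin ?expsum_ge0//.
  move: mE; rewrite /Rintegral -m0' => /eqP.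
  by rewrite fine_eq0 ?integrable_fin_num// => /eqP.
move/(ae_eq_integral_abs P0 measurableT) => [].
  exact/measurable_EFinP/measurable_expsum.
move=> B [mB B0 sB].
have : (P0 [set w | (1 <= npts Z w)%N] <= P0 B)%E.
  apply: le_measure; rewrite ?inE//; first exact: measurable_npts_gt0.
  move=> w /= Nw; apply: sB => /= /(_ I) [] /eqP.
  rewrite gt_eqF// /expsum; case: (npts Z w) Nw => // n _.
  rewrite big_ord_recl ltr_wpDr ?expR_gt0//.
  by apply: sumr_ge0 => j _; exact: expR_ge0.
by rewrite npts_gt0 B0 lee_fin ler10.
Qed.

(** Pointwise [N] is at least twice the indicator of [N >= 1] minus that of [N = 1], hence
    [E N >= 2 - P (N = 1) > 1]. It follows that [nu 0 > 0], so [nu s / s] blows up as [s] decreases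
    to [0]. *)
Lemma moment_gen0_gt1 : 1 < m 0.
Proof.
have p1 : fine (P0 [set w | npts Z w = 1%N]) < 1.
  by rewrite -lte_fin fineK// fin_num_measure//; exact: measurable_npts_eq1.
have h0 : - vartheta < 0 by rewrite oppr_lt0.
suff : 2 * fine (P0 [set w | (1 <= npts Z w)%N]) +
    (-1) * fine (P0 [set w | npts Z w = 1%N]) <= m 0.
  by rewrite npts_gt0 /=; lra.
apply: isint_le (isintD (isintZ 2 (isint_indic P0 measurable_npts_gt0))
  (isintZ (-1) (isint_indic P0 measurable_npts_eq1))) (isint_expsum h0) _ => w.
rewrite !indicE.
have -> : (w \in [set w | npts Z w = 1%N]) = (npts Z w == 1%N).
  by apply/idP/eqP; rewrite inE.
have -> : (w \in [set w | (1 <= npts Z w)%N]) = (1 <= npts Z w)%N.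
  by apply/idP/idP; rewrite inE.
have -> : expsum 0 w = (npts Z w)%:R.
  rewrite /expsum; under eq_bigr do rewrite mul0r expR0.
  by rewrite sumr_const card_ord.
case: (npts Z w) => [|[|n]] /=; rewrite ?mulr0 ?mulr1 ?addr0//.
  by lra.
by rewrite ler_nat.
Qed.

Lemma derivable_moment_gen a : - vartheta < a -> derivable m a 1.
Proof.
(* A third of the distance to [- vartheta], so that [a - 2 * eps] is still in the domain. *)
move=> ha; pose eps := (a + vartheta) / 3.
have eps0 : 0 < eps by rewrite divr_gt0//; lra.
have e3 : 3 * eps = a + vartheta by rewrite /eps; field.
have in_ x : `]a - eps, a + eps[%classic x -> - vartheta < x.
  by rewrite /= in_itv/= => /andP[]; lra.
pose G w := eps^-1 * (expsum (a + 2 * eps) w + expsum (a - 2 * eps) w).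
have h1 : - vartheta < a + 2 * eps by lra.
have h2 : - vartheta < a - 2 * eps by lra.
have [Gi _] := isintZ eps^-1 (isintD (isint_expsum h1) (isint_expsum h2)).
have der (x : R) (w : T0) : is_derive x (1 : R) (fun t : R => expsum t w : R)
    (\sum_(j < npts Z w) expR (x * pts Z j w) * pts Z j w).
  have -> : (fun t : R => expsum t w : R) = \sum_(j < npts Z w) (fun t : R =>
    expR (t * pts Z j w) : R).
    by apply/funext => t; rewrite fct_sumE.
  apply: is_derive_sum => j.
  apply: (@is_derive1_comp _ expR (fun t => t * pts Z j w)).
  have := is_deriveM (is_derive_id x 1) (is_derive_cst (pts Z j w) x (1 : R)).
  by move/is_derive_eq; apply; rewrite scaler0 add0r /GRing.scale/= mulr1.
suff dF : derivable (fun x => \int[P0]_w expsum x w) a 1.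
  apply: near_eq_derivable dF; near=> x.
  have [_ ->//] : isint P0 (expsum x) (m x).
  by apply: isint_expsum; near: x; exact: lt_nbhsr.
apply: (@derivable_under_integral R _ _ P0 expsum setT measurableT a (a - eps)
  (a + eps) _ _ _ G) => //.
    - by rewrite /= in_itv/=; lra.
    - by move=> x /in_ hx; have [] := isint_expsum hx.
    - move=> w; rewrite mulr_ge0 ?invr_ge0 ?(ltW eps0)// addr_ge0//; exact: expsum_ge0.
    - move=> x w; rewrite /= in_itv/= => /andP[x1 x2] _.
      rewrite partial1of2E (@derive_val _ _ _ _ _ _ _ (der x w)).
      rewrite /G -big_split/= big_distrr/=.
      apply: (le_trans (ler_norm_sum _ _ _)); apply: ler_sum => j _.
      rewrite normrM ger0_norm ?expR_ge0// -ler_pdivrMl ?invr_gt0// invrK.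
      set y := pts Z j w.
      (* The factor [|y|] produced by differentiation costs one shift of the exponent by [eps]; the
         distance from [x] to [a] costs another. This is why [G] uses [a + 2 * eps] and
         [a - 2 * eps], one for each sign of [y]. *)
      have y1 : eps * `|y| <= expR (eps * `|y|).
        by apply: le_trans (expR_ge1Dx _); rewrite lerDr.
      apply: (@le_trans _ _ (expR (x * y) * expR (eps * `|y|))).
        by rewrite mulrCA ler_wpM2l ?expR_ge0.
      rewrite -expRD; have [y0|y0] := leP 0 y.
        by rewrite ler_wpDr ?expR_ge0// ler_expR (ger0_norm y0); nra.
      by rewrite ler_wpDl ?expR_ge0// ler_expR (ltr0_norm y0); nra.
Unshelve. all: by end_near. Qed.

Lemma derivable_log_moment_gen a : - vartheta < a -> derivable nu a 1.
Proof.
move=> ha; have d1 := is_derive1_ln (moment_gen_gt0 ha).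
have d2 : is_derive a (1 : R) m ('D_1 m a).
  by apply: DeriveDef => //; exact: derivable_moment_gen.
by have [] := is_derive1_comp d1 d2.
Qed.

(* If [t |-> nu t / t] did not go below its value at [theta] to the right of
   [theta], its minimum over a segment [delta, theta] with [nu delta / delta]
   large would be a local one, hence a zero of its derivative and an upper
   bound of [theta0]. *)
Lemma log_moment_gen_ratio_decr (theta eps : R) : 0 < theta ->
  (theta%:E < theta0 P0 Z)%E -> 0 < eps ->
  exists2 s, theta < s < theta + eps & nu s / s < nu theta / theta.
Proof.
move=> t0 tt0 eps0; apply: contrapT => noS.
pose r (s : R) := nu s * s^-1.
have rmin s : theta <= s < theta + eps -> r theta <= r s.
  move=> /andP[]; rewrite le_eqVlt => /predU1P[->//|ts se].
  by rewrite leNgt; apply/negP => h; apply: noS; exists s => //; rewrite ts.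
have der (s : R) : 0 < s -> is_derive s (1 : R) r ('D_1 nu s * s^-1 - nu s / s ^+ 2).
  move=> s0; have hs : - vartheta < s by rewrite (lt_trans _ s0)// oppr_lt0.
  have d1 : is_derive s (1 : R) nu ('D_1 nu s).
    by apply: DeriveDef => //; exact: derivable_log_moment_gen.
  have d2 : is_derive s (1 : R) (fun t : R => t^-1) (- (s ^+ 2)^-1).
    have := is_deriveV (f := id) (lt0r_neq0 s0) (is_derive_id s (1 : R)).
    by rewrite /GRing.scale/= mulr1.
  have := is_deriveM d1 d2.
  move/is_derive_eq; apply.
  by rewrite /GRing.scale/= mulrN [RHS]addrC mulrC [in RHS]mulrC; congr (_ + _); ring.
have nu0 : 0 < nu 0 by rewrite /nu /log_moment_gen ln_gt0// moment_gen0_gt1.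
have cnu0 : {for 0, continuous nu}.
  apply: differentiable_continuous; apply/derivable1_diffP.
  by apply: derivable_log_moment_gen; rewrite oppr_lt0.
(* Near [0] one has [nu > nu 0 / 2 > 0] by continuity, so dividing by a small enough [del] exceeds
   any prescribed value. *)
have [del /andP[del0 delt] rdel] : exists2 del, 0 < del < theta & r theta < r del.
  have h1 : \forall x \near (0 : R), nu 0 / 2 < nu x.
    by apply: (cvgr_gt _ cnu0); lra.
  have h2 : \forall x \near (0 : R)^'+, nu 0 / 2 < nu x.
    by apply: cvg_within h1.
  near ((0 : R)^'+) => del.
  have del0 : 0 < del by near: del; exact: nbhs_right_gt.
  exists del; first by rewrite del0/=; near: del; exact: nbhs_right_lt.
  have nd : nu 0 / 2 < nu del by near: del.
  rewrite /r ltr_pdivlMr//; apply: le_lt_trans nd.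
  have : del < (nu 0 / 2) / (`|r theta| + 1).
    by near: del; apply: nbhs_right_lt; rewrite !divr_gt0// ltr_wpDl.
  rewrite ltr_pdivlMr ?ltr_wpDl// => h; have := ler_norm (r theta).
  rewrite -/(r theta); nra.
have cr : {within `[del, theta], continuous r}.
  apply: derivable_within_continuous => x; rewrite in_itv/= => /andP[dx _].
  by have [] := der x (lt_le_trans del0 dx).
have [c] := EVT_min (ltW delt) cr.
rewrite in_itv/= => /andP[dc ct] cmin.
have {}dc : del < c.
  rewrite lt_neqAle dc andbT; apply/eqP => dc'.
  by have := cmin theta; rewrite in_itv/= lexx ltW// -dc' => /(_ isT); lra.
have c0 : 0 < c by exact: lt_trans dc.
(* The minimiser [c] may be [theta] itself. The interval is therefore prolonged to [theta + eps],
   where [rmin] keeps [r] above [r theta], so that [c] is an interior minimum. *)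
have d0r : is_derive c (1 : R) r 0.
  apply: (@derive1_at_min _ r del (theta + eps)).
  - by lra.
  - move=> x; rewrite in_itv/= => /andP[dx _].
    by have [] := der x (lt_trans del0 dx).
  - by rewrite in_itv/= dc; lra.
  - move=> x; rewrite in_itv/= => /andP[dx xe].
    have [xt|/ltW tx] := leP x theta.
      by apply: cmin; rewrite in_itv/= ltW.
    apply: (@le_trans _ _ (r theta)); last by apply: rmin; rewrite tx.
    by apply: cmin; rewrite in_itv/= lexx ltW.
have : (theta0 P0 Z <= c%:E)%E.
  apply: ereal_inf_lbound; exists c => //=; split=> //.
  rewrite derive1E.
  have := @derive_val _ _ _ _ _ _ _ (der c c0).
  rewrite (@derive_val _ _ _ _ _ _ _ d0r) => /esym/eqP.
  rewrite subr_eq0 => /eqP h; rewrite -[RHS](divfK (lt0r_neq0 c0)) h.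
  by rewrite -/nu; field; rewrite gt_eqF.
by move/(lt_le_trans tt0); rewrite lte_fin ltNge ct.
Unshelve. all: by end_near. Qed.

(** With [q = s / theta] the quantity is [expR (nu s - q * nu theta)], below [1] exactly when
    [nu s / s < nu theta / theta]. The window [theta * min 1 p] to the right of [theta] enforces
    both [q <= 2] and [q < 1 + p]. *)
Lemma mean_weight_contraction (theta p : R) : 0 < theta ->
  (theta%:E < theta0 P0 Z)%E -> 0 < p ->
  exists2 q, 1 < q <= 2 /\ q < 1 + p & expR (- (q * nu theta)) * m (q * theta) < 1.
Proof.
move=> t0 tt0 p0; have eps0 : 0 < theta * Num.min 1 p by rewrite mulr_gt0//
  lt_min ltr01.
have [s /andP[ts se] rs] := log_moment_gen_ratio_decr t0 tt0 eps0.
have s0 : 0 < s by exact: lt_trans ts.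
have qt : s / theta * theta = s by rewrite divfK// gt_eqF.
have hmin : s / theta < 1 + Num.min 1 p.
  by rewrite ltr_pdivrMr// mulrDl mul1r [X in _ < _ + X]mulrC.
exists (s / theta).
  split; first (apply/andP; split).
  - by rewrite ltr_pdivlMr// mul1r.
  - by apply: ltW; apply: (lt_le_trans hmin); rewrite lerD2l ge_min lexx.
  - by apply: (lt_le_trans hmin); rewrite lerD2l ge_min lexx orbT.
rewrite qt; have hs : - vartheta < s by rewrite (lt_trans _ s0)// oppr_lt0.
rewrite -(lnK (x := m s)) ?posrE ?moment_gen_gt0// -expRD -/(log_moment_gen P0 Z s).
rewrite -expR0 ltr_expR -/nu addrC subr_lt0.
rewrite ltr_pdivrMr// in rs; apply: (lt_le_trans rs).
by rewrite le_eqVlt; apply/orP; left; apply/eqP; field; rewrite gt_eqF.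
Qed.

Section weights.
Variable theta : R.
Hypothesis theta_gt0 : 0 < theta.

Definition weight j w := expR (theta * pts Z j w - nu theta).

Lemma measurable_weight j : measurable_fun setT (weight j).
Proof.
apply: measurableT_comp => //; apply: measurable_funB => //.
exact: measurable_funM.
Qed.

Lemma weight_gt0 j w : 0 < weight j w.
Proof. exact: expR_gt0. Qed.

Lemma sum_weight_powR q w : \sum_(j < npts Z w) weight j w `^ q =
  expR (- (q * nu theta)) * expsum (q * theta) w.
Proof.
rewrite big_distrr/=; apply: eq_bigr => j _.
by rewrite /weight -expRM -expRD; congr expR; ring.
Qed.

Lemma isint_weight_powR q : 0 < q ->
  isint P0 (fun w => \sum_(j < npts Z w) weight j w `^ q)
    (expR (- (q * nu theta)) * m (q * theta)).
Proof.
move=> q0; apply: isint_eq (fun w => esym (sum_weight_powR q w)).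
apply/isintZ/isint_expsum; rewrite (@lt_trans _ _ 0) ?oppr_lt0//.
exact: mulr_gt0.
Qed.

Lemma isint_weight : isint P0 (fun w => \sum_(j < npts Z w) weight j w) 1.
Proof.
have := isint_weight_powR ltr01; rewrite !mul1r.
have ht : - vartheta < theta by rewrite (lt_trans _ theta_gt0)// oppr_lt0.
rewrite -[X in _ * X]lnK ?posrE ?moment_gen_gt0// -expRD addNr expR0.
move/isint_eq; apply=> w; apply: eq_bigr => j _.
by rewrite powRr1// ltW// weight_gt0.
Qed.

(** Dominate by [sum_powR_le]. The exponent [rho] of the weights can be large when [q] is close to
    [1 + p], but exponential moments of every positive order are finite. *)
Lemma isint_total_weight_powR (p q : R) : 1 < q -> q < 1 + p ->
  ('E_P0[fun w => ((npts Z w)%:R `^ (1 + p))%R] < +oo)%E ->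
  exists M, isint P0 (fun w => (\sum_(j < npts Z w) weight j w) `^ q) M.
Proof.
move=> q1 qp Np; set f := (f in isint _ f); exists (\int[P0]_w f w); split => //.
have mf : measurable_fun setT f.
  apply: (@measurableT_comp _ _ _ _ _ _ (@powR R ^~ q)).
    exact: measurable_powR.
  exact: (measurable_random_sum (measurable_funPT _) measurable_weight).
pose rho := q * ((1 + p) / (1 + p - q)).
have rho0 : 0 < rho by rewrite mulr_gt0 ?divr_gt0//; lra.
have [ig _] := isint_weight_powR rho0.
have iN : P0.-integrable setT (EFin \o (fun w => (npts Z w)%:R `^ (1 + p))).
  apply/integrableP; split.
    apply/measurable_EFinP.
    by apply: (measurable_fun_nat_index (G := fun k _ => k%:R `^ (1 + p))).
  move: Np; rewrite unlock; apply: le_lt_trans; rewrite le_eqVlt; apply/orP; left.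
  by apply/eqP; apply: eq_integral => w _; rewrite gee0_abs// lee_fin powR_ge0.
apply: (le_integrable measurableT _ _ (integrableD measurableT iN ig)).
  exact/measurable_EFinP.
move=> w _; rewrite /= lee_fin ger0_norm ?powR_ge0//.
apply: (le_trans _ (ler_norm _)).
apply: (@sum_powR_le R p q (npts Z w) (fun j => weight j w)) => [|j].
  by rewrite qp (lt_trans ltr01).
exact/ltW/weight_gt0.
Qed.

End weights.
End log_moment_generating_function.

(** * Laplace transforms *)

Section laplace_transform.
Context (R : realType) (mu : probability R R).
Hypothesis mu_ge0 : mu [set x : R | 0 <= x] = 1%E.
Hypothesis mu_mean : (\int[mu]_x x%:E < +oo)%E.

Definition mean := fine (\int[mu]_x x%:E)%E.

(** The absolute values give a Lipschitz function with values in [[0, 1]] on the whole line; for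
    [t >= 0] and [mu] carried by [[0, +oo[] it is the usual Laplace transform. *)
Definition laplace (t : R) := \int[mu]_y expR (- (`|t| * `|y|)).

Lemma ae_ge0 : {ae mu, forall x, 0 <= x}.
Proof.
exists (~` [set x : R | 0 <= x]); split => //.
  by apply: measurableC; rewrite -set_itvcy.
rewrite probability_setC ?mu_ge0 ?subee//.
by rewrite -set_itvcy.
Qed.

Lemma isint_norm_mean : isint mu (fun y : R => `|y|) mean.
Proof.
have E : (\int[mu]_x `|x%:E| = \int[mu]_x x%:E)%E.
  apply: ae_eq_integral => //.
  - by apply: measurableT_comp => //; exact/measurable_EFinP.
  - by apply: filterS ae_ge0 => x x0 _; rewrite gee0_abs// lee_fin.
split; last by rewrite /Rintegral /mean -E.
apply/integrableP; split; first by apply/measurable_EFinP; exact: measurableT_comp.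
by under eq_integral => x _ do rewrite /= normr_id; rewrite [X in (X < _)%E]E.
Qed.

Lemma mean_ge0 : 0 <= mean.
Proof. by have [_ <-] := isint_norm_mean; exact: Rintegral_ge0. Qed.

(** A zero mean would put all the mass at [0]. Positivity makes [ln] of the mean a genuine logarithm
    in the limit law. *)
Lemma mean_gt0 : ~ (forall A : set R, measurable A -> mu A = \d_(0 : R) A) ->
  0 < mean.
Proof.
move=> muN0; rewrite lt_neqAle mean_ge0 andbT; apply/eqP => c0; apply: muN0 => A mA.
have [ni nE] := isint_norm_mean.
have : (\int[mu]_w `|w%:E|)%E = 0%E.
  move: nE; rewrite /Rintegral -c0 => /eqP.
  by rewrite fine_eq0 ?integrable_fin_num// => /eqP.
move/(ae_eq_integral_abs mu measurableT) => [].
  exact/measurable_EFinP.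
move=> B [mB B0 sB].
have s0 (x : R) : x != 0 -> B x.
  by move=> x0; apply: sB => /= /(_ I) [] /eqP; rewrite (negbTE x0).
have sub0 (C : set R) : measurable C -> ~ C 0 -> mu C = 0%E.
  move=> mC C0; apply/eqP; rewrite eq_le measure_ge0 andbT -B0.
  apply: le_measure; rewrite ?inE// => x Cx; apply: s0.
  by apply/eqP => x0; apply: C0; rewrite -x0.
rewrite diracE; have [A0|/negP A0] := boolP (0 \in A); last first.
  by apply: sub0 => // ?; apply: A0; rewrite inE.
rewrite -[A]setCK probability_setC; last exact: measurableC.
rewrite sub0 ?sube0//; first exact: measurableC.
by apply; rewrite inE in A0.
Qed.

Lemma isint_laplace t : isint mu (fun y => expR (- (`|t| * `|y|))) (laplace t).
Proof.
apply: isint_unit => [|y].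
  apply: measurableT_comp => //; apply: measurableT_comp => //.
  by apply: measurable_funM => //; exact: measurableT_comp.
by rewrite expR_ge0 expR_le1 oppr_le0 mulr_ge0.
Qed.

Lemma laplace_lip : unit_lip mean laplace.
Proof.
split => [t|x y].
  have [ti _] := isint_laplace t.
  apply: Rintegral_unit; first by apply/measurable_EFinP; exact: measurable_int ti.
  by move=> y; rewrite expR_ge0 expR_le1 oppr_le0 mulr_ge0.
rewrite mulrC; apply: isint_dist (isint_laplace x) (isint_laplace y)
  (isintZ `|x - y| isint_norm_mean) _ => w.
have [_] := expRN_norm_lip (normr_ge0 w).
by move=> /(_ x y); rewrite !(mulrC `|w|).
Qed.

Lemma laplace0 : laplace 0 = 1.
Proof.
rewrite /laplace; under eq_Rintegral => y _ do rewrite normr0 mul0r oppr0 expR0.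
exact: Rintegral_cst1.
Qed.

Lemma truncated_mean_small eta : 0 < eta ->
  exists K : nat, exists2 v, isint mu (fun y => `|y| * (K%:R < `|y|)%R%:R) v & v <= eta.
Proof.
move=> eta0; pose f (K : nat) (y : R) := `|y| * (K%:R < `|y|)%R%:R.
have mf K : measurable_fun setT (f K).
  apply: measurable_funM; first exact: normr_measurable.
  rewrite (_ : (fun y => _) = \1_[set y : R | K%:R < `|y|]).
    apply: measurable_indic.
    rewrite (_ : [set y : R | _] = Num.norm @^-1` `]K%:R, +oo[%classic).
      rewrite -[X in measurable X]setTI.
      exact: (@normr_measurable R setT measurableT _ (measurable_itv _)).
    by apply/seteqP; split => y /=; rewrite in_itv/= andbT.
  apply/funext => y; rewrite indicE.
  have -> // : (y \in [set y : R | K%:R < `|y|]) = (K%:R < `|y|).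
  by apply/idP/idP; rewrite inE.
have [ni nE] := isint_norm_mean.
have fle K y : `|f K y| <= `|y|.
  by rewrite /f; case: ltP => _; rewrite ?mulr1 ?mulr0 ?normr_id ?normr0.
have fi K : mu.-integrable setT (EFin \o f K).
  apply: le_integrable ni => //; first exact/measurable_EFinP.
  by move=> y _; rewrite /= lee_fin normr_id.
have [||||| _ _ cf] := @dominated_convergence _ _ _ mu setT measurableT
   (fun n => EFin \o f n) (cst 0%E) (fun y => (`|y|)%:E).
- by move=> n; exact/measurable_EFinP.
- exact: measurable_cst.
- apply: aeW => y _; apply: (@cvg_near_cst _ _ _ _ \oo).
  near=> n; rewrite /= /f ltNge.
  have -> : `|y| <= n%:R by near: n; exact: nbhs_infty_ger.
  by rewrite mulr0.
- exact: ni.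
- by apply: aeW => y n _ /=; rewrite lee_fin.
rewrite integral0 in cf.
have /fine_cvgP[_ /cvgrPdist_le /(_ _ eta0) [K _ hK]] := cf.
exists K, (\int[mu]_y f K y); first by split; [exact: fi|].
apply: le_trans (ler_norm _) _; rewrite -normrN -[X in `|X|]add0r.
exact: (hK K (leqnn K)).
Unshelve. all: by end_near. Qed.

(** With a first moment only, the remainder [expR (- s y) - 1 + s y] is treated in two ranges: for
    [|y| > K] it is at most [s |y|], whose truncated mean is small; for [|y| <= K] it is at most
    [(s K) ^ q]. *)
Lemma laplace_expansion q : 1 < q <= 2 -> forall eta, 0 < eta ->
  exists2 B, 0 <= B & forall s, 0 <= s ->
    `|laplace s - expR (- (mean * s))| <= eta * s + B * s `^ q.
Proof.
move=> q12 eta eta0; have [K [v hv veta]] := truncated_mean_small eta0.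
(* The first term pays for the range [|y| <= K], the second for linearising
   [expR (- (mean * s))]. *)
exists (K%:R `^ q + mean `^ q); first by rewrite addr_ge0 ?powR_ge0.
move=> s s0; have c0 := mean_ge0.
have h1 : `|expR (- (mean * s)) - (1 - mean * s)| <= mean `^ q * s `^ q.
  have := expR_ge1Dx (- (mean * s)).
  have := expRN_le_powR q12 (mulr_ge0 c0 s0); rewrite powRM// => a b.
  by rewrite ger0_norm; lra.
have h2 : `|laplace s - (1 + (- s) * mean)| <= s * v + s `^ q * K%:R `^ q.
  apply: isint_dist (isint_laplace s) (isintD (isint_cst mu 1)
    (isintZ (- s) isint_norm_mean)) (isintD (isintZ s hv) (isint_cst mu _)) _ => y.
  rewrite (ger0_norm s0).
  have a := expR_ge1Dx (- (s * `|y|)).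
  have sy : 0 <= s * `|y| by exact: mulr_ge0.
  rewrite ger0_norm; last by nra.
  have [Ky|yK] := ltP K%:R `|y|.
    have : expR (- (s * `|y|)) <= 1 by rewrite expR_le1 oppr_le0.
    have := mulr_ge0 (powR_ge0 s q) (powR_ge0 K%:R q).
    by rewrite mulr1; nra.
  have := expRN_le_powR q12 sy.
  have : (s * `|y|) `^ q <= s `^ q * K%:R `^ q.
    rewrite -powRM//; case/andP: q12 => q1 q2.
    by apply: ge0_ler_powR; rewrite ?nnegrE ?mulr_ge0 ?ler_wpM2l//; lra.
  by rewrite !mulr0; nra.
have := ler_distD (1 - mean * s) (laplace s) (expR (- (mean * s))).
rewrite [X in _ <= _ + X -> _]distrC => h3.
have : s * v <= eta * s by rewrite mulrC ler_wpM2r.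
by rewrite mulNr mulrC in h2; nra.
Qed.

End laplace_transform.

(** * Equality in law of point processes *)

Section mfun_of.
Context d d' (T : measurableType d) (T' : measurableType d').
Variables (f : T -> T') (mf : measurable_fun setT f).
Let mf_mixin := isMeasurableFun.Build _ _ _ _ f mf.
Definition mfun_of : {mfun T >-> T'} := HB.pack f mf_mixin.
End mfun_of.

Section counts.
Context d (T : measurableType d) (R : realType).
Variables (Z : point_process T R) (k : nat) (B : 'I_k -> set R).
Hypothesis mB : forall i, measurable (B i).

Definition counts (w : T) : {ffun 'I_k -> nat} :=
  [ffun i => \sum_(j < npts Z w) (pts Z j w \in B i)]%N.

Lemma pp_measureE w i : pp_measure Z w (B i) = (counts w i)%:R%:E.
Proof.
rewrite /pp_measure ffunE natr_sum -sumEFin; apply: eq_bigr => j _.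
by rewrite diracE.
Qed.

Lemma preimage_counts (c : {ffun 'I_k -> nat}) : [set w | counts w = c] =
  [set w | forall i, pp_measure Z w (B i) = (c i)%:R%:E].
Proof.
apply/seteqP; split => w /= => [<- i|h]; first exact: pp_measureE.
apply/ffunP => i; have := h i; rewrite pp_measureE => -[] /eqP.
by rewrite eqr_nat => /eqP.
Qed.

Lemma measurable_counts c : measurable [set w | counts w = c].
Proof.
have -> : [set w | counts w = c] =
    \bigcap_(i in [set: 'I_k]) ((fun w => (counts w i)%:R : R) @^-1` [set (c i)%:R]).
  apply/seteqP; split => w /= => [<- //|h].
  by apply/ffunP => i; apply/eqP; rewrite -(eqr_nat R); apply/eqP; exact: h.
apply: fin_bigcap_measurable => [|i _]; first exact: finite_finset.
rewrite -[X in measurable X]setTI.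
have mc : measurable_fun setT (fun w => (counts w i)%:R : R).
  rewrite (_ : (fun w => _) = fun w => \sum_(j < npts Z w) \1_(B i) (pts Z j w)).
    apply: (measurable_random_sum (g := fun j w => \1_(B i) (pts Z j w))) => // j.
    by apply: measurableT_comp => //; exact: measurable_indic.
  by apply/funext => w; rewrite ffunE natr_sum; apply: eq_bigr => j _; rewrite indicE.
by apply: mc => //; exact: measurable_set1.
Qed.

(** Coding the vector of counts by one natural number turns its law into a measure on [nat],
    determined by the masses of singletons. *)
Lemma measurable_pickle_counts : measurable_fun setT (fun w => choice.pickle
  (counts w)).
Proof.
move=> _ A _; rewrite setTI.
have -> : (fun w => choice.pickle (counts w)) @^-1` A = \bigcup_(n in A)
    (if choice.pickle_inv n is Some c then [set w | counts w = c] else set0).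
  apply/seteqP; split => [w /= Aw|w [n An]].
    by exists (choice.pickle (counts w)) => //; rewrite choice.pickleK_inv.
  case E : (@choice.pickle_inv {ffun 'I_k -> nat} n) => [c|//] /= ->.
  by move: An; have := @choice.pickle_invK {ffun 'I_k -> nat} n; rewrite E /= => ->.
apply: bigcup_measurable => n _; case: choice.pickle_inv => [c|]//.
exact: measurable_counts.
Qed.

End counts.

Section law_of_point_process.
Context (R : realType) d (T : measurableType d) (P : probability T R)
  (Z : point_process T R).
Context d' (T' : measurableType d') (P' : probability T' R)
  (Z' : point_process T' R).
Hypothesis ZZ' : pp_same_law P Z P' Z'.

Lemma same_law_counts k (B : 'I_k -> set R) (F : {ffun 'I_k -> nat} -> R) :
  (forall i, measurable (B i)) -> (forall c, 0 <= F c) ->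
  \int[P]_w F (counts Z B w) = \int[P']_w F (counts Z' B w).
Proof.
move=> mB F0.
pose X := mfun_of (measurable_pickle_counts Z mB).
pose X' := mfun_of (measurable_pickle_counts Z' mB).
(* Decodes and applies [F]; the value [0] at numbers that code nothing is never reached. *)
pose G n := (if choice.pickle_inv n is Some c then F c else 0)%:E : \bar R.
have G0 n : (0 <= G n)%E by rewrite lee_fin; case: choice.pickle_inv.
have XE : (fun w => (F (counts Z B w))%:E) = G \o X.
  by apply/funext => w; rewrite /G /= choice.pickleK_inv.
have X'E : (fun w => (F (counts Z' B w))%:E) = G \o X'.
  by apply/funext => w; rewrite /G /= choice.pickleK_inv.
rewrite /Rintegral XE X'E.
have e d1 (T1 : measurableType d1) (P1 : probability T1 R) (X1 : {RV P1 >-> nat}) :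
    (\int[P1]_w (G \o X1) w = \int[distribution P1 X1]_n G n)%E.
  by rewrite ge0_integral_distribution.
rewrite !e; congr fine; apply: eq_measure_integral => A _ _.
(* Reduce to singletons: the event that the counts have code [n] is either one of those compared by
   [pp_same_law] or empty. *)
have -> : A = \bigcup_(n in A) [set n].
  by apply/seteqP; split => [n An|n [m Am ->]//]; exists n.
have tA : trivIset A (fun n : nat => [set n]).
  by move=> i j _ _ [x [/= -> ->]].
rewrite !measure_bigcup//; apply: eq_eseriesr => n _.
change (P ((fun w => choice.pickle (counts Z B w)) @^-1` [set n]) =
  P' ((fun w => choice.pickle (counts Z' B w)) @^-1` [set n])).
case E : (@choice.pickle_inv {ffun 'I_k -> nat} n) => [c|].
  have En : choice.pickle c = n by have := @choice.pickle_invK {ffun 'I_k -> nat}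
    n; rewrite E.
  have H d1 (T1 : measurableType d1) (Z1 : point_process T1 R) :
      (fun w => choice.pickle (counts Z1 B w)) @^-1` [set n] =
      [set w | forall i, pp_measure Z1 w (B i) = (c i)%:R%:E].
    rewrite -preimage_counts -En; apply/seteqP; split => w /=.
      by move/(pcan_inj choice.pickleK).
    by move=> ->.
  by rewrite !H; exact: ZZ'.
have H d1 (T1 : measurableType d1) (Z1 : point_process T1 R) :
    (fun w => choice.pickle (counts Z1 B w)) @^-1` [set n] = set0.
  by apply/seteqP; split => w //= h; move: E; rewrite -h choice.pickleK_inv.
by rewrite !H !measure0.
Qed.

(* When [g] takes finitely many values the product is a function of counts of
   level sets of [g]; approximate [g] by such functions. *)
Lemma same_law_prod (g : R -> R) : measurable_fun setT g ->
  (forall x, 0 <= g x <= 1) ->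
  \int[P]_w \prod_(j < npts Z w) g (pts Z j w) =
  \int[P']_w \prod_(j < npts Z' w) g (pts Z' j w).
Proof.
move=> mg g01.
(* [gn n] rounds [g] down to a multiple of [1 / (n + 1)]. Since [g] may equal [1] there are [n + 2]
   levels. *)
pose t n x := Num.trunc (g x * n.+1%:R).
pose gn n x : R := (t n x)%:R / n.+1%:R.
have gn0 x n : 0 <= g x * n.+1%:R by rewrite mulr_ge0//; case/andP: (g01 x).
have tE n x : (t n x)%:R <= g x * n.+1%:R < (t n x).+1%:R by exact: truncn_itv.
have gn01 n x : 0 <= gn n x <= 1.
  case/andP: (g01 x) => g0 g1; case/andP: (tE n x) => t1 _.
  rewrite divr_ge0//= ler_pdivrMr// mul1r (le_trans t1)// ler_piMl//.
have tlt n x : (t n x < n.+2)%N.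
  rewrite ltnS -(ler_nat R); have /andP[_] := gn01 n x.
  by rewrite /gn ler_pdivrMr// mul1r.
pose B n (i : 'I_n.+2) := [set x | t n x = i].
have mB n i : measurable (B n i).
  have -> : B n i = (fun x => g x * n.+1%:R) @^-1` `[(i:nat)%:R, (i:nat).+1%:R[%classic.
    apply/seteqP; split => x /=; rewrite in_itv/=.
      by move=> <-; exact: tE.
    by move=> h; apply/eqP; rewrite /t truncn_eq.
  rewrite -[X in measurable X]setTI.
  by apply: (measurable_funM mg) => //; exact: measurable_itv.
have prodE d1 (T1 : measurableType d1) (Z1 : point_process T1 R) n w :
    \prod_(j < npts Z1 w) gn n (pts Z1 j w) =
    \prod_(i < n.+2) ((i : nat)%:R / n.+1%:R) ^+ counts Z1 (B n) w i.
  rewrite (partition_big (fun j : 'I_(npts Z1 w) => Ordinal (tlt n (pts Z1 j w)))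
    predT)//=.
  apply: eq_bigr => i _.
  rewrite (eq_bigr (fun=> (i : nat)%:R / n.+1%:R)); last first.
    by move=> j /eqP <-.
  rewrite prodr_const ffunE; congr (_ ^+ _).
  rewrite -sum1_card big_mkcond/=; apply: eq_bigr => j _.
  rewrite unfold_in/=; case: ifPn => h.
    by apply/esym/eqP; rewrite eqb1; apply/mem_set; rewrite /B/= -(eqP h).
  apply/esym/eqP; rewrite eqb0; apply: contra h; rewrite inE /B/= => h.
  by apply/eqnP.
have cvg d1 (T1 : measurableType d1) (P1 : probability T1 R)
    (Z1 : point_process T1 R) :
    \int[P1]_w \prod_(j < npts Z1 w) gn n (pts Z1 j w) @[n --> \oo] -->
    \int[P1]_w \prod_(j < npts Z1 w) g (pts Z1 j w).
  have mgn n : measurable_fun setT (gn n).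
    apply: measurable_funM => //.
    apply: (measurable_fun_nat_index (N := t n) (G := fun (k : nat) (_ : R) =>
      k%:R : R)) => //.
    move=> _ A _; rewrite setTI.
    have -> : t n @^-1` A = \bigcup_(i in A) [set x | t n x = i].
      by apply/seteqP; split => [x Ax|x [i Ai ti]]; [exists (t n x)|rewrite
        /preimage/= ti].
    apply: bigcup_measurable => i _.
    have [hi|hi] := ltnP i n.+2; first exact: (mB n (Ordinal hi)).
    rewrite (_ : [set x | _] = set0)//; apply/seteqP; split => x //= h.
    by have := tlt n x; rewrite h ltnNge hi.
  apply: bounded_convergence.
  - move=> n; apply: (measurable_random_prod (g := fun j w => gn n (pts Z1 j w)))
      => // j.
    exact: measurableT_comp.
  - move=> n w; apply/andP; split.
      by apply: prodr_ge0 => j _; case/andP: (gn01 n (pts Z1 j w)).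
    by apply: prodr_ile1 => j; rewrite gn01.
  - move=> w; apply: cvg_big => [|i _]; first exact: mul_continuous.
    apply/cvgrPdist_le => e e0; near=> n.
    have /andP[t1 t2] := tE n (pts Z1 i w).
    have n0 : 0 < n.+1%:R :> R by [].
    have : n.+1%:R^-1 <= e.
      rewrite invf_ple ?posrE//; apply: (@le_trans _ _ n%:R).
        by near: n; exact: nbhs_infty_ger.
      by rewrite ler_nat.
    apply: le_trans; rewrite -(ler_pM2r n0) mulVf ?gt_eqF// -[X in _ * X](gtr0_norm n0).
    rewrite -normrM mulrBl /gn divfK ?gt_eqF// ger0_norm ?subr_ge0//.
    by move: t2; rewrite -natr1; lra.
apply: cvg_unique (cvg _ _ P Z) _ => //.
have -> : (fun n => \int[P]_w \prod_(j < npts Z w) gn n (pts Z j w)) =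
          (fun n => \int[P']_w \prod_(j < npts Z' w) gn n (pts Z' j w)).
  apply/funext => n.
  under eq_Rintegral do rewrite prodE.
  under [RHS]eq_Rintegral do rewrite prodE.
  apply: (same_law_counts (F := fun c => \prod_(i < n.+2) ((i : nat)%:R /
    n.+1%:R) ^+ c i)) => // c.
  by apply: prodr_ge0 => i _; rewrite exprn_ge0// divr_ge0.
exact: cvg.
Unshelve. all: by end_near. Qed.

End law_of_point_process.

(** * Independence *)

Section fubini_of_independence.
Local Open Scope ereal_scope.
Context d (T : measurableType d) (R : realType) (P : probability T R).
Context d1 d2 (T1 : measurableType d1) (T2 : measurableType d2).
Variables (U : {mfun T >-> T1}) (V : {mfun T >-> T2}).
Hypothesis UV : forall A B, measurable A -> measurable B ->
  P (U @^-1` A `&` V @^-1` B) = P (U @^-1` A) * P (V @^-1` B).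

(** The joint law of [U] and [V] is the product of their laws; then apply Tonelli. *)
Lemma ge0_integral_independent (f : T1 * T2 -> \bar R) :
  measurable_fun setT f -> (forall z, 0 <= f z) ->
  \int[P]_w f (U w, V w) = \int[P]_w \int[P]_w' f (U w, V w').
Proof.
move=> mf f0.
pose W := mfun_of (measurable_fun_pair (measurable_funPT U) (measurable_funPT V)).
transitivity (\int[distribution P W]_z f z).
  by rewrite ge0_integral_distribution.
transitivity (\int[distribution P U \x distribution P V]_z f z).
  apply: eq_measure_integral => A mA _; apply/esym.
  by apply: product_measure_unique => // B C mB mC; rewrite -UV.
rewrite fubini_tonelli1// ge0_integral_distribution//.
- apply: eq_integral => w _; rewrite /= /fubini_F ge0_integral_distribution//.
  apply: measurableT_comp => //; exact: measurable_fun_pair.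
- exact: measurable_fun_fubini_tonelli_F.
- by move=> x; exact: integral_ge0.
Qed.

End fubini_of_independence.

Section independence.
Context d (T : measurableType d) (R : realType) (P : probability T R).
Context (I : choiceType) (F : I -> set_system T).
Hypothesis F_indep : mutually_independent P F.
Hypothesis F_sigma : forall i, sigma_algebra setT (F i).
Hypothesis F_meas : forall i, F i `<=` measurable.

Let F_T i : F i setT.
Proof. by case: (F_sigma i) => F0 FD _; rewrite -[setT]setD0; exact: FD. Qed.

Let F_I i : setI_closed (F i).
Proof.
have sT X : F i X -> X `<=` setT by [].
by have [/(_ (F_sigma i))[_ _ _]] := sigma_algebraP sT.
Qed.

Definition joint_sigma (D : set I) : set_system T := <<s \bigcup_(i in D) F i >>.

Lemma joint_sigma_meas D : joint_sigma D `<=` measurable.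
Proof.
apply: smallest_sub; first exact: sigma_algebra_measurable.
by move=> A [i _]; exact: F_meas.
Qed.

Lemma joint_sigmaS D D' : D `<=` D' -> joint_sigma D `<=` joint_sigma D'.
Proof.
move=> DD'; apply: sub_sigma_algebra2 => A [i /DD' D'i FA]; by exists i.
Qed.

Lemma sub_joint_sigma D i : D i -> F i `<=` joint_sigma D.
Proof. by move=> Di A FA; apply: sub_sigma_algebra; exists i. Qed.

(** A pi-system argument: finite intersections [G] of events from the [F j], [j] in [D], generate
    the joint sigma-algebra, and on them the finite measures [P (. & A)] and [P A * P (.)] agree by
    independence. *)
Lemma independent_joint_sigma (i : I) (D : set I) : ~ D i -> forall A B,
  F i A -> joint_sigma D B -> P (A `&` B) = (P A * P B)%E.
Proof.
move=> Di A B FA DB.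
pose G : set_system T := [set C | exists (J : {fset I}) (S : I -> set T),
  (forall j, j \in J -> D j /\ F j (S j)) /\ C = \bigcap_(j in [set` J]) S j].
have mA := F_meas FA.
have FG : \bigcup_(j in D) F j `<=` G.
  move=> C [j Dj FC]; exists [fset j]%fset, (fun=> C); split.
    by move=> k; rewrite inE => /eqP ->.
  by apply/seteqP; split => [w Cw k _|w /(_ j)]//=; apply; rewrite inE.
have G_T : G setT.
  exists fset0, (fun=> setT); split => //.
  by apply/seteqP; split.
have G_I : setI_closed G.
  move=> _ _ [J1 [S1 [H1 ->]]] [J2 [S2 [H2 ->]]].
  exists (J1 `|` J2)%fset, (fun j => (if j \in J1 then S1 j else setT) `&`
    (if j \in J2 then S2 j else setT)); split.
    move=> j; rewrite inE => /orP[j1|j2].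
      have [Dj F1] := H1 j j1; split => //; rewrite j1; apply: F_I => //.
      by case: ifPn => // /H2[].
    have [Dj F1] := H2 j j2; split => //; rewrite j2; apply: F_I => //.
    by case: ifPn => // /H1[].
  apply/seteqP; split => w /=.
    move=> [h1 h2] j _; split; case: ifPn => // ?; [exact: h1|exact: h2].
  move=> h; split => j /= Jj; have := h j; rewrite /= inE Jj ?orbT => /(_ isT) [];
    by rewrite ?Jj.
have G_meas : G `<=` measurable.
  move=> _ [J [S [H ->]]]; apply: fin_bigcap_measurable.
    exact: finite_fset.
  by move=> j /= /H[_]; exact: F_meas.
have pA : (0 <= fine (P A))%R by rewrite fine_ge0.
rewrite setIC -[P A]fineK ?fin_num_measure//.
have GB : <<s G >> B by apply: sub_sigma_algebra2 DB.
pose m1 : {measure set T -> \bar R} := mrestr P mA.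
pose m2 : {measure set T -> \bar R} := mscale (NngNum pA) P.
change (m1 B = m2 B).
apply: (g_sigma_algebra_measure_unique G G_meas (fun=> setT)) GB => //.
- by rewrite bigcup_const//; exists 0%N.
- move=> _ [J [S [H ->]]].
  change (P (\bigcap_(j in [set` J]) S j `&` A) =
    ((fine (P A))%:E * P (\bigcap_(j in [set` J]) S j))%E).
  rewrite fineK ?fin_num_measure//.
  have iJ : i \notin J by apply/negP => /H[].
  pose S' j := if j == i then A else S j.
  have S'J j : j \in J -> S' j = S j.
    by move=> jJ; rewrite /S'; case: eqP => // ji; move: iJ; rewrite -ji jJ.
  have -> : \bigcap_(j in [set` J]) S j `&` A =
      \bigcap_(j in [set` (i |` J)%fset]) S' j.
    apply/seteqP; split => w /=.
      move=> [h Aw] j /=; rewrite !inE => /orP[/eqP ->|jJ]; first by rewrite /S' eqxx.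
      by rewrite S'J//; exact: h.
    move=> h; split => [j /= jJ|].
      by rewrite -S'J//; apply: h => /=; rewrite !inE jJ orbT.
    by have := h i; rewrite /= !inE eqxx /S' eqxx; apply.
  rewrite (F_indep (J := (i |` J)%fset)); last first.
    move=> j; rewrite !inE => /orP[/eqP ->|jJ]; first by rewrite /S' eqxx.
    by rewrite S'J//; have [] := H j jJ.
  rewrite big_fsetU1//= {1}/S' eqxx; congr (_ * _)%E.
  rewrite (F_indep (J := J)); last by move=> j /H[].
  by rewrite !big_seq_fsetE/=; apply: eq_bigr => j _; rewrite S'J ?fsvalP.
- move=> k; change (P (setT `&` A) < +oo)%E.
  by rewrite setTI ltey_eq fin_num_measure.
Qed.

(** The same carrier [T] with a smaller sigma-algebra: measurability on [TG D] expresses that a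
    function depends only on the information in the [F i], [i] in [D]. *)
Let TG (D : set I) := g_sigma_algebraType (\bigcup_(i in D) F i).
Let TF (i : I) := g_sigma_algebraType (F i).

Lemma measurable_joint_sigmaS d' (T' : measurableType d') D D' (f : T -> T') :
  D `<=` D' -> measurable_fun [set: TG D] (f : TG D -> T') ->
  measurable_fun [set: TG D'] (f : TG D' -> T').
Proof. by move=> DD' mf _ A mA; apply: (joint_sigmaS DD'); exact: mf. Qed.

Lemma measurable_joint_sigmaT d' (T' : measurableType d') D (f : T -> T') :
  measurable_fun [set: TG D] (f : TG D -> T') -> measurable_fun setT f.
Proof. by move=> mf _ A mA; apply: (@joint_sigma_meas D); exact: mf. Qed.

Lemma measurable_id_joint_sigma D i : D i ->
  measurable_fun [set: TG D] (id : TG D -> TF i).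
Proof.
move=> Di _ A mA; rewrite setTI.
have FA : F i A by move: mA; rewrite /measurable/= sigma_algebra_id.
exact: (@sub_joint_sigma D i).
Qed.

Variables (h : I -> R * T -> R) (a : I -> T -> R).
Hypothesis h_meas : forall i, measurable_fun [set: R * TF i] (h i : R * TF i -> R).
Hypothesis h_unit : forall i z, 0 <= h i z <= 1.

Let measurable_id_TF i : measurable_fun setT (id : T -> TF i).
Proof.
move=> _ A mA; rewrite setTI; apply: (@F_meas i).
by move: mA; rewrite /measurable/= sigma_algebra_id.
Qed.

Definition cond_mean (i : I) (x : R) := \int[P]_w h i (x, w).

Let h_sec i x : measurable_fun setT (fun w => h i (x, w)).
Proof.
have g : measurable_fun setT (fun w : T => (x, w) : R * TF i).
  by apply: measurable_fun_pair => //; exact: measurable_id_TF.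
exact: (measurableT_comp (@h_meas i) g).
Qed.

Lemma cond_meanE i x : (cond_mean i x)%:E = (\int[P]_w (h i (x, w))%:E)%E.
Proof.
rewrite /cond_mean fineK//; apply: integrable_fin_num => //.
exact: (@integrable_unit _ _ _ P _ (@h_sec i x) (fun w => h_unit i (x, w))).
Qed.

Lemma cond_mean_unit i x : 0 <= cond_mean i x <= 1.
Proof. exact: (Rintegral_unit P (@h_sec i x) (fun w => h_unit i (x, w))). Qed.

Lemma measurable_cond_mean i : measurable_fun setT (cond_mean i).
Proof.
apply/measurable_EFinP.
have := @measurable_fun_fubini_tonelli_F _ _ R (TF i) R
  (distribution P (mfun_of (@measurable_id_TF i))) (EFin \o h i).
rewrite (_ : fubini_F _ _ = EFin \o cond_mean i).
  apply; first exact/measurable_EFinP.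
  by move=> z; rewrite /= lee_fin; case/andP: (h_unit i z).
apply/funext => x; rewrite /fubini_F ge0_integral_distribution//=.
- by rewrite cond_meanE.
- apply/measurable_EFinP; apply: (measurableT_comp (@h_meas i)).
  exact: measurable_fun_pair.
- by move=> w; rewrite lee_fin; case/andP: (h_unit i (x, w)).
Qed.

(** Conditional expectation given [D], in the only form needed: with [a i] known from [D], each
    factor is averaged over its own source [F i]. One index is treated at a time; its mean, a
    function of [a i], is then absorbed into [f]. *)
Lemma Rintegral_prod_cond (D : set I) (s : seq I) (f : T -> R) : uniq s ->
  (forall i, i \in s -> ~ D i) ->
  (forall i, i \in s -> measurable_fun [set: TG D] (a i : TG D -> R)) ->
  measurable_fun [set: TG D] (f : TG D -> R) -> (forall w, 0 <= f w <= 1) ->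
  \int[P]_w (f w * \prod_(i <- s) h i (a i w, w)) =
  \int[P]_w (f w * \prod_(i <- s) cond_mean i (a i w)).
Proof.
elim: s f => [|i s IH] f; first by under eq_Rintegral do rewrite !big_nil;
  move=> *; under [RHS]eq_Rintegral do rewrite big_nil.
move=> /andP[is_ us] sD am fm f01.
(* Everything in the integrand except the randomness of factor [i] is measurable for [E], and [i] is
   outside [E]. *)
pose E := D `|` [set` s].
have iE : ~ E i.
  by move=> [/(sD _ (mem_head _ _))|/= hi]//; move: is_; rewrite hi.
pose f1 w := f w * \prod_(j <- s) h j (a j w, w).
have f101 w : 0 <= f1 w <= 1.
  have /andP[a0 a1] := f01 w; apply/andP; split.
    by rewrite mulr_ge0// prodr_ge0// => j _; case/andP: (h_unit j (a j w, w)).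
  by rewrite mulr_ile1// ?prodr_ge0 ?prodr_ile1// => j; case/andP: (h_unit j (a j
    w, w)).
have f1m : measurable_fun [set: TG E] (f1 : TG E -> R).
  apply: measurable_funM.
    by apply: measurable_joint_sigmaS fm => j; left.
  apply: measurable_prod => j js.
  have idm : measurable_fun [set: TG E] (id : TG E -> TF j).
    by apply: measurable_id_joint_sigma; right.
  have ajm : measurable_fun [set: TG E] (a j : TG E -> R).
    apply: (@measurable_joint_sigmaS _ _ D); first by move=> k; left.
    by apply: am; rewrite inE js orbT.
  exact: (measurableT_comp (@h_meas j) (measurable_fun_pair ajm idm)).
have aim : measurable_fun [set: TG E] (a i : TG E -> R).
  apply: (@measurable_joint_sigmaS _ _ D); first by move=> k; left.
  by apply: am; exact: mem_head.
have Um : measurable_fun [set: TG E] ((fun w => (f1 w, a i w)) : TG E -> R * R).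
  exact: measurable_fun_pair.
pose U := mfun_of (measurable_joint_sigmaT Um).
pose V := mfun_of (@measurable_id_TF i).
have UV A B : measurable A -> measurable B ->
    P (U @^-1` A `&` V @^-1` B) = (P (U @^-1` A) * P (V @^-1` B))%E.
  move=> mA mB; rewrite setIC muleC; apply: (independent_joint_sigma iE).
    by move: mB; rewrite /measurable/= sigma_algebra_id.
  by have := Um measurableT A mA; rewrite setTI.
transitivity (\int[P]_w (f1 w * cond_mean i (a i w))).
  rewrite /Rintegral; congr fine.
  (* The absolute value makes the integrand nonnegative everywhere, as Tonelli requires; it changes
     nothing at [z.1.1 = f1 w]. *)
  pose phi' (z : (R * R) * TF i) : \bar R := (`|z.1.1| * h i (z.1.2, z.2))%:E.
  have phi'm : measurable_fun setT phi'.
    apply/measurable_EFinP; apply: measurable_funM.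
      by apply: measurableT_comp => //; exact: measurableT_comp.
    apply: (measurableT_comp (@h_meas i)).
    by apply: measurable_fun_pair => //; exact: measurableT_comp.
  have phi'0 z : (0 <= phi' z)%E.
    by rewrite lee_fin mulr_ge0//; case/andP: (h_unit i (z.1.2, z.2)).
  have := ge0_integral_independent UV phi'm phi'0; rewrite /phi' /=.
  have nf1 w : `|f1 w| = f1 w by rewrite ger0_norm//; case/andP: (f101 w).
  under eq_integral do rewrite nf1.
  under [in X in _ = X -> _]eq_integral do rewrite nf1.
  have <- : (\int[P]_w (f w * \prod_(j <- i :: s) h j (a j w, w))%:E =
     \int[P]_w (f1 w * h i (a i w, w))%:E)%E.
    by apply: eq_integral => w _; rewrite big_cons /f1; congr (_%:E); ring.
  move=> ->; apply: eq_integral => w _.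
  rewrite EFinM cond_meanE -ge0_integralZl//.
  - exact/measurable_EFinP/h_sec.
  - by move=> w' _; rewrite lee_fin; case/andP: (h_unit i (a i w, w')).
  - by rewrite lee_fin; case/andP: (f101 w).
transitivity (\int[P]_w ((f w * cond_mean i (a i w)) * \prod_(j <- s) h j (a j w, w))).
  by apply: eq_Rintegral => w _; rewrite /f1; ring.
rewrite IH//.
- by apply: eq_Rintegral => w _; rewrite big_cons; ring.
- by move=> j js; apply: sD; rewrite inE js orbT.
- by move=> j js; apply: am; rewrite inE js orbT.
- apply: measurable_funM => //.
  apply: (measurableT_comp (measurable_cond_mean i)).
  by apply: am; exact: mem_head.
- move=> w; case/andP: (f01 w) => a0 a1; case/andP: (cond_mean_unit i (a i w)) => b0 b1.
  by rewrite mulr_ge0// mulr_ile1.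
Qed.

End independence.

(** * The branching random walk *)

(** [pp_sigma] and [brw_sigma] reveal a value [S] only where the point or particle exists; a
    function of it must be constant elsewhere. *)
Lemma measurable_guarded d (T : measurableType d) (R : realType) (b : T -> bool)
    (S : T -> R) (g : R -> R) (c : R) : measurable_fun setT g ->
  (forall B, measurable B -> measurable [set w | b w /\ B (S w)]) ->
  measurable_fun setT (fun w => if b w then g (S w) else c).
Proof.
move=> mg mS _ A mA; rewrite setTI.
have mb : measurable [set w | b w].
  rewrite (_ : [set w | b w] = [set w | b w /\ setT (S w)]); first exact: mS.
  by apply/seteqP; split => w /=; [split|case].
have -> : (fun w => if b w then g (S w) else c) @^-1` A =
    [set w | b w /\ (g @^-1` A) (S w)] `|`
    (if `[< A c >] then ~` [set w | b w] else set0).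
  apply/seteqP; split => w /=.
    case: ifPn => bw Ac; first by left.
    by right; rewrite asboolT//; exact/negP.
  case=> [[-> //]|]; case: asboolP => // Ac /= /negP/negbTE -> //.
apply: measurableU; last by case: asbool => //; exact: measurableC.
by apply: mS; rewrite -[X in measurable X]setTI; exact: mg.
Qed.

Lemma measurable_expR_affine (R : realType) (a b : R) :
  measurable_fun setT (fun x : R => expR (a * x - b)).
Proof.
by apply: measurableT_comp => //; apply: measurable_funB => //.
Qed.

Section enumeration.
Variable (n : nat).

Definition first_words (K : nat) : seq (n.-tuple nat) :=
  pmap (@choice.pickle_inv (n.-tuple nat)) (iota 0 K).

Lemma first_words_uniq K : uniq (first_words K).
Proof. exact: (pmap_uniq (@choice.pickle_invK (n.-tuple nat)) (iota_uniq 0 K)). Qed.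

Lemma mem_first_words K (v : n.-tuple nat) : (choice.pickle v < K)%N ->
  v \in first_words K.
Proof.
move=> vK; rewrite mem_pmap; apply/mapP; exists (choice.pickle v).
  by rewrite mem_iota.
by rewrite choice.pickleK_inv.
Qed.

(** The sequence is eventually constant: [g] is finite, and words outside it contribute the factor
    [1]. *)
Lemma prod_first_words_cvg (R : realType) (g : seq (seq nat)) (F : seq nat -> R) :
  uniq g -> (forall v, v \in g -> size v = n) ->
  (forall v, v \notin g -> F v = 1) ->
  \prod_(v <- first_words K) F v @[K --> \oo] --> \prod_(v <- g) F v.
Proof.
move=> ug gn gF; apply: (@cvg_near_cst _ _ _ _ \oo).
pose m := \max_(v <- pmap (insub : seq nat -> option (n.-tuple nat)) g)
  (choice.pickle v).+1.
exists m => // K /= mK.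
pose S := [seq val v | v <- first_words K].
rewrite (_ : \prod_(v <- first_words K) F v = \prod_(v <- S) F v); last first.
  by rewrite big_map.
have US : uniq S by rewrite map_inj_uniq ?first_words_uniq//; exact: val_inj.
rewrite (bigID (mem g))/= [X in _ * X]big1; last by move=> v; exact: gF.
rewrite mulr1 -big_filter; apply: perm_big; apply: uniq_perm => //.
  exact: filter_uniq.
move=> v; rewrite mem_filter; have [vg|//] := boolP (v \in g).
have vn := gn v vg; rewrite /= -[v]/(tval (Tuple (introT eqP vn))).
apply: map_f; apply: mem_first_words; apply: leq_trans mK.
rewrite /m; apply: (@leq_bigmax_seq _ _ predT
  (fun v : n.-tuple nat => (choice.pickle v).+1)) => //.
rewrite mem_pmap; apply/mapP; exists v => //.
have vn' : size v == n by apply/eqP.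
by rewrite (insubT (fun s : seq nat => size s == n) vn'); congr Some; exact: val_inj.
Qed.

End enumeration.

Section pp_sigma.
Context d (T : measurableType d) (R : realType) (Z : point_process T R).
Let TZ := g_sigma_algebraType (pp_sigma Z).

Lemma pp_sigma_sigma_algebra : sigma_algebra setT (pp_sigma Z).
Proof. exact: smallest_sigma_algebra. Qed.

Lemma measurable_pts_itv j (B : set R) : measurable B ->
  measurable [set w | (j < npts Z w)%N /\ B (pts Z j w)].
Proof.
move=> mB; apply: measurableI.
  rewrite -[X in measurable X]setTI.
  exact: (@measurable_funPT _ _ _ _ (npts Z) measurableT [set k | (j < k)%N]).
rewrite -[X in measurable X]setTI.
exact: (@measurable_funPT _ _ _ _ (pts Z j) measurableT B mB).
Qed.

Lemma pp_sigma_measurable : pp_sigma Z `<=` measurable.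
Proof.
apply: smallest_sub; first exact: sigma_algebra_measurable.
by move=> _ [j [B [mB ->]]]; exact: measurable_pts_itv.
Qed.

Let mpts j (B : set R) : measurable B ->
  measurable ([set w | (j < npts Z w)%N /\ B (pts Z j w)] : set TZ).
Proof.
move=> mB; rewrite /measurable/= sigma_algebra_id; last exact: pp_sigma_sigma_algebra.
by apply: sub_sigma_algebra; exists j, B.
Qed.

Lemma pp_sigma_guarded (g : R -> R) c j : measurable_fun setT g ->
  measurable_fun [set: TZ]
    ((fun w => if (j < npts Z w)%N then g (pts Z j w) else c) : TZ -> R).
Proof.
move=> mg; apply: (@measurable_guarded _ TZ R (fun w => (j < npts Z w)%N) (pts Z
  j)) => // B mB.
exact: mpts.
Qed.

Lemma pp_sigma_npts : measurable_fun [set: TZ] (npts Z : TZ -> nat).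
Proof.
have mlt j : measurable ([set w | (j < npts Z w)%N] : set TZ).
  rewrite (_ : [set w | _] = [set w | (j < npts Z w)%N /\ setT (pts Z j w)]).
    exact: mpts.
  by apply/seteqP; split => w /=; [split|case].
move=> _ A _; rewrite setTI.
have -> : (npts Z : TZ -> nat) @^-1` A = \bigcup_(n in A)
    ((if n is k.+1 then [set w | (k < npts Z w)%N] else setT) `\`
     [set w | (n < npts Z w)%N]).
  apply/seteqP; split => [w Aw|w [n An [h1 /negP h2]]].
    exists (npts Z w) => //; split => /=; last by rewrite ltnn.
    by case E : (npts Z w) => [|k]//=; rewrite E.
  rewrite /preimage/=; suff -> : npts Z w = n by [].
  apply/eqP; rewrite eqn_leq leqNgt h2 /=.
  by case: n h1 {An h2}.
apply: bigcup_measurable => n _; apply: measurableD; last exact: mlt.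
by case: n => // k; exact: mlt.
Qed.

End pp_sigma.

(** * The branching property as iteration of the smoothing transform *)

Section branching_random_walk.
Context d (T : measurableType d) (R : realType) (P : probability T R).
Variable X : seq nat -> point_process T R.
Variables (theta nu : R).

Definition child_weight (u : seq nat) (j : nat) (w : T) : R :=
  if (j < npts (X u) w)%N then expR (theta * pts (X u) j w - nu) else 0.

(* [t exp (theta S(v) - |v| nu)] for a particle [v] alive, and [0] for a word
   that is not born. *)
Fixpoint path_weight (t : R) (v : seq nat) (w : T) : R :=
  if v is j :: u then path_weight t u w * child_weight u j w else t.

Lemma mem_generationS n j u w : (j :: u \in generation X n.+1 w) =
  (u \in generation X n w) && (j < npts (X u) w)%N.
Proof.
apply/allpairsPdep/andP => [[u' [j' [u'n]]]|[un jN]].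
  by rewrite mem_iota add0n /= => jN [-> ->].
by exists u, j; rewrite mem_iota add0n.
Qed.

Lemma generation_size n v w : v \in generation X n w -> size v = n.
Proof.
elim: n v => [|n IH] v; first by rewrite inE => /eqP ->.
case: v => [|j u]; first by case/allpairsPdep => u' [j' []].
by rewrite mem_generationS => /andP[/IH /= -> _].
Qed.

Lemma generation_uniq n w : uniq (generation X n w).
Proof.
elim: n => //= n IH; apply: allpairs_uniq_dep => //.
  by move=> u _; exact: iota_uniq.
by move=> [u j] [u' j'] _ _ /= [-> ->].
Qed.

Lemma path_weightE t v w : path_weight t v w =
  if v \in generation X (size v) w
  then t * expR (theta * position X v w - (size v)%:R * nu) else 0.
Proof.
elim: v => [|j u IH].
  by rewrite /= ?inE ?eqxx mulr0 mul0r subr0 expR0 mulr1.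
rewrite [size _]/= mem_generationS /= IH /child_weight.
case: (u \in _); last by rewrite mul0r.
case: ifP => _; last by rewrite mulr0.
rewrite /= -mulrA -expRD; congr (_ * expR _).
by rewrite -natr1; ring.
Qed.

Lemma path_weight_dead t n v w : size v = n -> v \notin generation X n w ->
  path_weight t v w = 0.
Proof. by move=> vn nv; rewrite path_weightE vn (negbTE nv). Qed.

Lemma prod_generationS n t (f : R -> R) w :
  \prod_(v <- generation X n.+1 w) f (path_weight t v w) =
  \prod_(u <- generation X n w) \prod_(j < npts (X u) w)
    f (path_weight t u w * expR (theta * pts (X u) j w - nu)).
Proof.
rewrite [generation _ _.+1 _]/= big_allpairs_dep; apply: eq_bigr => u _.
have -> : iota 0 (npts (X u) w) = index_iota 0 (npts (X u) w).
  by rewrite /index_iota subn0.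
rewrite big_mkord; apply: eq_bigr => j _.
by rewrite /= /child_weight ltn_ord.
Qed.

Let F u := pp_sigma (X u).
Let TG (D : set (seq nat)) := g_sigma_algebraType (\bigcup_(u in D) F u).

Lemma measurable_path_weight t v (D : set (seq nat)) :
  (forall u, (size u < size v)%N -> D u) ->
  measurable_fun [set: TG D] (path_weight t v : TG D -> R).
Proof.
elim: v => [|j u IH] Dv; first exact: measurable_cst.
apply: measurable_funM; first by apply: IH => u' /ltnW; exact: Dv.
have Du : D u by exact: Dv.
have m1 : measurable_fun [set: g_sigma_algebraType (F u)]
    (child_weight u j : g_sigma_algebraType (F u) -> R).
  apply: (@pp_sigma_guarded _ _ _ (X u) (fun x => expR (theta * x - nu))).
  exact: measurable_expR_affine.
have m2 := measurable_id_joint_sigma (fun u => pp_sigma_sigma_algebra (X u)) Du.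
exact: (measurableT_comp m1 m2).
Qed.

Definition brw_mean n (f : R -> R) t :=
  \int[P]_w \prod_(v <- generation X n w) f (path_weight t v w).

Lemma measurable_path_weightT t v : measurable_fun setT (path_weight t v).
Proof.
apply: (@measurable_joint_sigmaT _ T _ F _ _ _ setT) => [u|].
  exact: pp_sigma_measurable.
exact: measurable_path_weight.
Qed.

Lemma prod_generation_cvg n (H : seq nat -> R) w :
  (forall v, size v = n -> v \notin generation X n w -> H v = 1) ->
  \prod_(v <- first_words n K) H v @[K --> \oo] -->
  \prod_(v <- generation X n w) H v.
Proof.
move=> H1; pose H' v := if size v == n then H v else 1.
rewrite (_ : (fun K => _) = fun K => \prod_(v <- first_words n K) H' v); last first.
  by apply/funext => K; apply: eq_bigr => v _; rewrite /H' size_tuple eqxx.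
rewrite (_ : \prod_(v <- _) H v = \prod_(v <- generation X n w) H' v); last first.
  by apply: eq_big_seq => v /generation_size vn; rewrite /H' vn eqxx.
apply: prod_first_words_cvg.
- exact: generation_uniq.
- by move=> v; exact: generation_size.
- by move=> v vg; rewrite /H'; case: eqP => // vn; exact: H1.
Qed.

Lemma measurable_prod_generation n (H : seq nat -> T -> R) :
  (forall v, measurable_fun setT (H v)) ->
  (forall v w, size v = n -> v \notin generation X n w -> H v w = 1) ->
  measurable_fun setT (fun w => \prod_(v <- generation X n w) H v w).
Proof.
move=> mH H1; apply: (measurable_fun_cvg
    (h := fun K w => \prod_(v <- first_words n K) H v w)) => [K|w _].
  by apply: measurable_prod => v _; exact: mH.
by apply: prod_generation_cvg => v; exact: H1.
Qed.

Lemma Rintegral_first_words_cvg n (H : seq nat -> T -> R) :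
  (forall v, measurable_fun setT (H v)) -> (forall v w, 0 <= H v w <= 1) ->
  (forall v w, size v = n -> v \notin generation X n w -> H v w = 1) ->
  \int[P]_w \prod_(v <- first_words n K) H v w @[K --> \oo] -->
  \int[P]_w \prod_(v <- generation X n w) H v w.
Proof.
move=> mH H01 H1; apply: bounded_convergence.
- by move=> K; apply: measurable_prod => v _; exact: mH.
- move=> K w; rewrite prodr_ge0/= => [|v _]; last by case/andP: (H01 v w).
  by apply: prodr_ile1 => v; rewrite H01.
- by move=> w; apply: prod_generation_cvg => v; exact: H1.
Qed.

Context d0 (T0 : measurableType d0) (P0 : probability T0 R)
  (Z : point_process T0 R).
Hypothesis XZ : is_brw X P P0 Z.

Let offspring_weight j w := expR (theta * pts Z j w - nu).
Let Gamma := smooth P0 (npts Z) offspring_weight.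

(* Condition on the first [n] generations. *)
Lemma brw_meanS L n f t : unit_lip L f -> f 0 = 1 ->
  brw_mean n.+1 f t = brw_mean n (Gamma f) t.
Proof.
move=> fL f0; have mf := unit_lip_measurable fL; have [f01 _] := fL.
have [indep law] := XZ.
(* The product over the children of [u] when [u] itself has weight [z.1]. *)
pose h (u : seq nat) (z : R * T) := \prod_(j < npts (X u) z.2) f (z.1 *
  child_weight u j z.2).
have h_unit u z : 0 <= h u z <= 1.
  rewrite /h prodr_ge0/= => [|j _]; last by case/andP: (f01 (z.1 * child_weight u
    j z.2)).
  by apply: prodr_ile1 => j; rewrite f01.
have h_meas u : measurable_fun [set: R * g_sigma_algebraType (F u)]
    (h u : R * g_sigma_algebraType (F u) -> R).
  apply: (measurable_random_prod (N := fun z : R * g_sigma_algebraType (F u) =>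
    npts (X u) z.2)
    (g := fun j z => f (z.1 * child_weight u j z.2))).
    by apply: (measurableT_comp (pp_sigma_npts (Z := X u))).
  move=> j; apply: measurableT_comp => //; apply: measurable_funM => //.
  have m1 : measurable_fun [set: g_sigma_algebraType (F u)]
      (child_weight u j : g_sigma_algebraType (F u) -> R).
    apply: (@pp_sigma_guarded _ _ _ (X u) (fun x => expR (theta * x - nu))).
    exact: measurable_expR_affine.
  exact: (measurableT_comp m1).
(* Here the law of the offspring of [u] is replaced by that of [Z]. *)
have condE u x : cond_mean P h u x = Gamma f x.
  rewrite /Gamma /smooth /offspring_weight.
  rewrite -(same_law_prod (law u) (g := fun y => f (x * expR (theta * y - nu)))).
  - apply: eq_Rintegral => w _; apply: eq_bigr => j _.
    by rewrite /= /child_weight ltn_ord.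
  - apply: measurableT_comp => //; apply: measurable_funM => //.
    exact: measurable_expR_affine.
  - by move=> y; exact: f01.
have sigmaF u : sigma_algebra setT (F u) by exact: pp_sigma_sigma_algebra.
have measF u : F u `<=` measurable by exact: pp_sigma_measurable.
have h_measT v : measurable_fun setT (fun w => h v (path_weight t v w, w)).
  have idm : measurable_fun setT (id : T -> g_sigma_algebraType (F v)).
    move=> _ A mA; rewrite setTI; apply: (@measF v).
    by move: mA; rewrite /measurable/= sigma_algebra_id.
  exact: (measurableT_comp (@h_meas v) (measurable_fun_pair
    (measurable_path_weightT t v) idm)).
(* Both sides are limits over the lists of the first [K] words; for each [K] the two finite products
   have the same mean. *)
have c1 : \int[P]_w \prod_(v <- first_words n K) h v (path_weight t v w, w) @[K
  --> \oo] -->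
    brw_mean n.+1 f t.
  rewrite (_ : brw_mean n.+1 f t =
      \int[P]_w \prod_(v <- generation X n w) h v (path_weight t v w, w)); last first.
    apply: eq_Rintegral => w _; rewrite prod_generationS.
    apply: eq_bigr => u _; apply: eq_bigr => j _.
    by rewrite /= /child_weight ltn_ord.
  apply: (Rintegral_first_words_cvg (H := fun v w => h v (path_weight t v w, w))) => //.
  move=> v w vn vg; rewrite /h /= big1// => j _.
  by rewrite (path_weight_dead _ vn vg) mul0r.
have c2 : \int[P]_w \prod_(v <- first_words n K) cond_mean P h v (path_weight t v w)
    @[K --> \oo] --> brw_mean n (Gamma f) t.
  rewrite (_ : brw_mean n (Gamma f) t =
      \int[P]_w \prod_(v <- generation X n w) cond_mean P h v (path_weight t v
        w)); last first.
    by apply: eq_Rintegral => w _; apply: eq_bigr => u _; rewrite condE.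
  apply: (Rintegral_first_words_cvg (H := fun v w => cond_mean P h v (path_weight
    t v w))).
  - move=> v; exact: (measurableT_comp
      (measurable_cond_mean P sigmaF measF h_meas h_unit v)
      (measurable_path_weightT t v)).
  - by move=> v w; exact: (cond_mean_unit P sigmaF measF h_meas h_unit).
  - move=> v w vn vg; rewrite (path_weight_dead _ vn vg) /cond_mean.
    rewrite -[RHS](Rintegral_cst1 P); apply: eq_Rintegral => w' _.
    by rewrite /h /= big1// => j _; rewrite mul0r.
apply: cvg_unique c1 _ => //.
rewrite (_ : (fun K => _) = fun K => \int[P]_w \prod_(v <- first_words n K)
    cond_mean P h v (path_weight t v w)) //.
(* The weights of words of length [n] depend only on the displacements of shorter words, whereas
   their own offspring lie outside [D]. *)
apply/funext => K; pose D : set (seq nat) := [set u | (size u < n)%N].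
have := Rintegral_prod_cond indep sigmaF measF (h := h) (a := path_weight t)
  h_meas h_unit (D := D) (s := [seq tval v | v <- first_words n K]) (f := cst 1).
rewrite map_inj_uniq ?first_words_uniq; last exact: val_inj.
move=> /(_ isT) H.
transitivity (\int[P]_w (cst 1 w *
    \prod_(i <- [seq tval v | v <- first_words n K]) h i (path_weight t i w, w))).
  by apply: eq_Rintegral => w _; rewrite mul1r big_map.
rewrite H; first by apply: eq_Rintegral => w _; rewrite mul1r big_map.
- by move=> _ /mapP[v _ ->]; rewrite /D /= size_tuple ltnn.
- move=> _ /mapP[v _ ->]; apply: measurable_path_weight => u.
  by rewrite /D/= size_tuple.
- exact: measurable_cst.
- by move=> w; rewrite ler01 lexx.
Qed.

(** Conditioning removes the last generation and changes [f] into [Gamma f], so the induction runs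
    over all [f]. The condition [f 0 = 1] survives, as [Gamma f 0] averages a product of factors
    [f 0]. *)
Lemma brw_meanE L n f t : (forall g, unit_lip L g -> unit_lip L (Gamma g)) ->
  unit_lip L f -> f 0 = 1 -> brw_mean n f t = iter n Gamma f t.
Proof.
move=> GL; elim: n f t => [|n IH] f t fL f0.
  rewrite /brw_mean -[RHS](Rintegral_cst1 P); apply: eq_Rintegral => w _.
  by rewrite big_seq1.
rewrite (brw_meanS _ _ fL f0) IH ?iterSr//; first exact: GL.
rewrite /Gamma /smooth -[RHS](Rintegral_cst1 P0); apply: eq_Rintegral => w _.
by rewrite big1// => j _; rewrite mul0r.
Qed.

End branching_random_walk.

(** * The modified last generation *)

Section exponential_variable.
Context d (T : measurableType d) (R : realType) (P : probability T R).
Variable E : {mfun T >-> R}.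
Hypothesis E_law : forall A : set R, measurable A ->
  P (E @^-1` A) = exponential_prob 1 A.

Let mE (A : set R) : measurable A -> measurable (E @^-1` A).
Proof. by move=> mA; rewrite -[X in measurable X]setTI; exact: measurable_funPT. Qed.

Lemma exponential_lt0 : P (E @^-1` `]-oo, 0[%classic) = 0%E.
Proof.
rewrite E_law//; apply: integral0_eq => x; rewrite /= in_itv/= => x0.
by rewrite lt0_exponential_pdf.
Qed.

Lemma exponential_eq (x : R) : P (E @^-1` [set x]) = 0%E.
Proof. by rewrite E_law//; exact: integral_set1. Qed.

Lemma exponential_gt0_ae : {ae P, forall w, 0 < E w}.
Proof.
exists (E @^-1` `]-oo, 0[%classic `|` E @^-1` [set 0]); split.
- by apply: measurableU; apply: mE.
- rewrite measureU0; [exact: exponential_lt0|exact: mE|exact: mE|exact: exponential_eq].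
- move=> w /= /negP; rewrite -leNgt le_eqVlt => /predU1P[->|E0]; [by right|left].
  by rewrite /= in_itv.
Qed.

(** For [x] nonzero the event differs from [E > |x|] only within the null events [E < 0] and
    [E = |x|]. The absolute values avoid any sign condition on the arguments. *)
Lemma exponential_norm_ge (x : R) :
  P [set w | `|x| <= `|E w|] = (expR (- `|x|))%:E.
Proof.
have [->|x0] := eqVneq x 0.
  rewrite normr0 oppr0 expR0 (_ : [set w | _] = setT) ?probability_setT//.
  by apply/seteqP; split => w //= _; exact: normr_ge0.
have nx0 : 0 < `|x| by rewrite normr_gt0.
have PE : P (E @^-1` `]`|x|, +oo[%classic) = (expR (- `|x|))%:E.
  rewrite (_ : `]`|x|, +oo[%classic = ~` (`[0, `|x|]%classic `|` `]-oo, 0[%classic)).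
    rewrite -preimage_setC probability_setC; last by apply: mE; exact: measurableU.
    rewrite preimage_setU measureU0; [|exact: mE|exact: mE|exact: exponential_lt0].
    have e := E_law (measurable_itv `[0, `|x|]).
    rewrite exponential_prob_itv0c// mulN1r in e.
    rewrite [X in (_ - X)%E](_ : _ = (1 - (expR (- `|x|))%:E)%E)//.
    change ((1 - (1 - expR (- `|x|)))%:E = (expR (- `|x|))%:E); congr (_%:E); ring.
  apply/seteqP; split => y /=; rewrite !in_itv/= ?andbT.
    by move=> xy [/andP[y0]|]; [rewrite leNgt xy|rewrite ltNge (ltW (lt_trans nx0 xy))].
  move=> h; rewrite ltNge; apply/negP => yx; apply: h.
  by have [y0|y0] := leP 0 y; [left|right].
have mA : measurable [set w | `|x| <= `|E w|].
  rewrite (_ : [set w | _] = E @^-1` (Num.norm @^-1` `[`|x|, +oo[%classic)).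
    apply: mE; rewrite -[X in measurable X]setTI.
    exact: (@normr_measurable R setT measurableT _ (measurable_itv _)).
  by apply/seteqP; split => w /=; rewrite in_itv/= andbT.
apply/eqP; rewrite eq_le -PE; apply/andP; split; last first.
  apply: le_measure; rewrite ?inE//; first exact: mE.
  move=> w /=; rewrite in_itv/= andbT => h; apply: ltW.
  exact: lt_le_trans h (ler_norm _).
have m0 : measurable (E @^-1` `]-oo, 0[%classic `|` E @^-1` [set `|x|]).
  by apply: measurableU; apply: mE.
have P0 : P (E @^-1` `]-oo, 0[%classic `|` E @^-1` [set `|x|]) = 0%E.
  rewrite measureU0; [exact: exponential_lt0|exact: mE|exact: mE|exact: exponential_eq].
have <- : P (E @^-1` `]`|x|, +oo[%classic `|`
    (E @^-1` `]-oo, 0[%classic `|` E @^-1` [set `|x|])) = P (E @^-1` `]`|x|,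
      +oo[%classic).
  by rewrite measureU0//; exact: mE.
apply: le_measure; rewrite ?inE//.
  by apply: measurableU => //; exact: mE.
move=> w /= h; rewrite !in_itv/= andbT.
have [E0|E0] := ltP (E w) 0; first by right; left.
rewrite (ger0_norm E0) le_eqVlt in h; case/predU1P: h => h; first by right; right.
by left.
Qed.

End exponential_variable.

Lemma bigmaxe_leP (R : realType) (I : eqType) (s : seq I) (G : I -> \bar R) (x :
  \bar R) :
  (\big[maxe/-oo%E]_(i <- s) G i <= x)%E <-> forall i, i \in s -> (G i <= x)%E.
Proof.
elim: s => [|i s IH]; first by rewrite big_nil; split => // _; exact: leNye.
rewrite big_cons ge_max; split => [/andP[h /IH hs] j|h].
  by rewrite inE => /predU1P[->//|]; exact: hs.
by rewrite h ?mem_head//=; apply/IH => j js; apply: h; rewrite inE js orbT.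
Qed.

Section last_progeny_modification.
Context d (T : measurableType d) (R : realType) (P : probability T R).
Variable X : seq nat -> point_process T R.
Variables Y E : seq nat -> {mfun T >-> R}.
Variables (theta nu : R).
Hypothesis theta_gt0 : 0 < theta.

Lemma measurable_alive v : measurable [set w | v \in generation X (size v) w].
Proof.
elim: v => [|j u IH].
  rewrite (_ : [set w | _] = setT)//; apply/seteqP; split => w // _.
rewrite (_ : [set w | _] = [set w | u \in generation X (size u) w] `&`
    [set w | (j < npts (X u) w)%N /\ setT (pts (X u) j w)]).
  by apply: measurableI => //; exact: measurable_pts_itv.
apply/seteqP; split => w; rewrite /= [size _]/= mem_generationS.
  by move=> /andP[].
by move=> [-> [->]].
Qed.

Lemma measurable_position v : measurable_fun setT (position X v).
Proof. by elim: v => [|j u IH]; [exact: measurable_cst|exact: measurable_funD]. Qed.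

Lemma brw_sigma_measurable n : brw_sigma X n `<=` measurable.
Proof.
apply: smallest_sub; first exact: sigma_algebra_measurable.
move=> _ [v [B [_ mB ->]]]; apply: measurableI; first exact: measurable_alive.
by rewrite -[X in measurable X]setTI; exact: measurable_position.
Qed.

Lemma measurable_path_weight_brw n t v : (size v <= n)%N ->
  measurable_fun [set: g_sigma_algebraType (brw_sigma X n)]
    (path_weight X theta nu t v : g_sigma_algebraType (brw_sigma X n) -> R).
Proof.
move=> vn; rewrite (_ : path_weight _ _ _ _ _ = fun w =>
  if v \in generation X (size v) w
  then t * expR (theta * position X v w - (size v)%:R * nu) else 0); last first.
  by apply/funext => w; exact: path_weightE.
apply: (@measurable_guarded _ (g_sigma_algebraType (brw_sigma X n)) R
  (fun w => v \in generation X (size v) w) (position X v)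
  (fun y => t * expR (theta * y - (size v)%:R * nu))).
  by apply: measurable_funM => //; exact: measurable_expR_affine.
move=> B mB; rewrite /measurable/= sigma_algebra_id; last exact: smallest_sigma_algebra.
by apply: sub_sigma_algebra; exists v, B.
Qed.

Definition modified_position (v : seq nat) (w : T) : \bar R :=
  ((position X v w)%:E + (theta^-1)%:E * (lne (Y v w)%:E - lne (E v w)%:E))%E.

Lemma measurable_lne_comp (S : T -> R) : measurable_fun setT S ->
  measurable_fun setT (fun w => lne (S w)%:E).
Proof.
move=> mS; rewrite (_ : (fun w => _) = fun w =>
    if 0 < S w then (ln (S w))%:E else -oo%E); last first.
  apply/funext => w; case: ltP => S0; first by rewrite lne_EFin.
  by rewrite le0_lneNy// lee_fin.
apply: measurable_fun_ifT => //.
  by apply: measurable_fun_ltr.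
apply/measurable_EFinP; apply: measurableT_comp => //; exact: measurable_ln.
Qed.

Lemma measurable_modified_position v : measurable_fun setT (modified_position v).
Proof.
apply: emeasurable_funD; first by apply/measurable_EFinP; exact: measurable_position.
apply: measurable_funeM; apply: emeasurable_funB; apply: measurable_lne_comp;
  exact: measurable_funPT.
Qed.

Lemma measurable_lpm_le n (x : R) :
  measurable [set w | (lpm_max X Y E theta n w <= x%:E)%E].
Proof.
have -> : [set w | (lpm_max X Y E theta n w <= x%:E)%E] = \bigcap_(k in [set: nat])
    (if @choice.pickle_inv (n.-tuple nat) k is Some v
     then ~` [set w | val v \in generation X (size (val v)) w] `|`
          [set w | (modified_position v w <= x%:E)%E] else setT).
  apply/seteqP; split => w /=.
    move=> /bigmaxe_leP h k _; case: choice.pickle_inv => [v|]//=.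
    have [vg|vg] := boolP (val v \in generation X (size (val v)) w); last by
      left; exact/negP.
    by right; apply: h; move: vg; rewrite size_tuple.
  move=> h; apply/bigmaxe_leP => v vg; have vn := generation_size vg.
  have vn' : size v == n by apply/eqP.
  have := h (choice.pickle (Tuple vn')) I; rewrite choice.pickleK_inv /=.
  by case=> //; rewrite vn.
apply: bigcap_measurableType => k _; case: choice.pickle_inv => [v|]//.
apply: measurableU; first by apply: measurableC; exact: measurable_alive.
rewrite -[X in measurable X]setTI.
have := measurable_modified_position (val v).
move=> /(_ measurableT [set y | (y <= x%:E)%E]); apply.
rewrite (_ : [set y | _] = `]-oo, x%:E]%classic); first exact: emeasurable_itv.
by apply/seteqP; split => y /=; rewrite in_itv.
Qed.

(** Multiply by [theta] and exponentiate. *)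
Lemma modified_position_le n x v w : 0 <= Y v w -> 0 < E v w ->
  v \in generation X n w ->
  (modified_position v w <= (x + nu / theta * n%:R)%:E)%E =
  (`|path_weight X theta nu (expR (- theta * x)) v w * Y v w| <= `|E v w|).
Proof.
move=> Y0 E0 vg; have vn := generation_size vg.
rewrite (gtr0_norm E0) path_weightE vn vg -expRD.
rewrite ger0_norm ?mulr_ge0 ?expR_ge0//.
rewrite /modified_position (lne_EFin E0).
(* Here [log 0 = -oo]: the left side holds trivially and the right side reads [0 <= E]. *)
have [Y0'|Y0'] := eqVneq (Y v w) 0.
  rewrite Y0' mulr0 (ltW E0) le0_lneNy// addNye gt0_muleNy ?addeNy ?leNye//.
  by rewrite lte_fin invr_gt0.
have {}Y0 : 0 < Y v w by rewrite lt_neqAle eq_sym Y0'.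
rewrite (lne_EFin Y0) -EFinB -EFinM -EFinD lee_fin.
rewrite -[in RHS](lnK Y0) -expRD -[in RHS](lnK E0) ler_expR.
rewrite -(ler_pM2l theta_gt0).
have -> : theta * (position X v w + theta^-1 * (ln (Y v w) - ln (E v w))) =
  theta * position X v w + ln (Y v w) - ln (E v w) by field; rewrite gt_eqF.
have -> : theta * (x + nu / theta * n%:R) = theta * x + n%:R * nu.
  by field; rewrite gt_eqF.
by apply/idP/idP; lra.
Qed.

Variable mu : probability R R.
Hypothesis mu_ge0 : mu [set x : R | 0 <= x] = 1%E.
Hypothesis mu_mean : (\int[mu]_x x%:E < +oo)%E.
Hypothesis YE : is_modification X Y E P mu.

Let pw := path_weight X theta nu.

(** The event and the product of indicators agree where all marks of generation [n] satisfy [Y >= 0]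
    and [E > 0], which holds almost surely. *)
Lemma lpm_max_prob n x : (0 < n)%N ->
  P [set w | (lpm_max X Y E theta n w - (nu / theta * n%:R)%:E <= x%:E)%E] =
  (\int[P]_w \prod_(v <- generation X n w)
     (`|pw (expR (- theta * x)) v w * Y v w| <= `|E v w|)%R%:R)%:E.
Proof.
move=> n0; have [Ylaw Elaw _] := YE n0.
set t := expR _.
pose H v w : R := (`|pw t v w * Y v w| <= `|E v w|)%R%:R.
have mH v : measurable_fun setT (H v).
  have mb : measurable_fun setT (fun w => `|pw t v w * Y v w| <= `|E v w|).
    apply: measurable_fun_ler.
      apply: measurableT_comp; first exact: normr_measurable.
      by apply: measurable_funM => //; exact: measurable_path_weightT.
    by apply: measurableT_comp; first exact: normr_measurable.
  rewrite (_ : H v = fun w => if `|pw t v w * Y v w| <= `|E v w| then 1 else 0).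
    exact: measurable_fun_ifT.
  by apply/funext => w; rewrite /H; case: leP.
have H01 v w : 0 <= H v w <= 1 by rewrite /H; case: (boolP (`|pw t v w * Y v w|
  <= `|E v w|)); rewrite ?ler01 ?lexx.
have H1 v w : size v = n -> v \notin generation X n w -> H v w = 1.
  by move=> vn vg; rewrite /H /pw (path_weight_dead _ _ _ vn vg) mul0r normr0 normr_ge0.
have mprod := measurable_prod_generation mH H1.
have prod01 w : 0 <= \prod_(v <- generation X n w) H v w <= 1.
  rewrite prodr_ge0/= => [|v _]; last by case/andP: (H01 v w).
  by apply: prodr_ile1 => v; rewrite H01.
rewrite (_ : [set w | _] =
  [set w | (lpm_max X Y E theta n w <= (x + nu / theta * n%:R)%:E)%E]); last first.
  by apply/seteqP; split => w; rewrite /mkset leeBlDr// -EFinD.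
set A := [set w | _]; have mA : measurable A by exact: measurable_lpm_le.
rewrite [in RHS]/Rintegral fineK; last first.
  apply: integrable_fin_num => //.
  exact: (integrable_unit P mprod prod01).
rewrite -[A in LHS]setIT -integral_indic//.
apply: ae_eq_integral => //.
- by apply/measurable_EFinP; exact: measurable_indic.
- exact/measurable_EFinP.
(* Words of length [n] are countable; indexing them by their codes combines the null sets into
   one. *)
have aeY : {ae P, forall w, forall k : nat,
    if @choice.pickle_inv (n.-tuple nat) k is Some v then 0 <= Y v w /\ 0 < E v w
      else True}.
  apply: ae_foralln => k; case: choice.pickle_inv => [v|]; last exact: aeW.
  have e0 := exponential_gt0_ae (Elaw v).
  have y0 : {ae P, forall w, 0 <= Y v w}.
    have mY : measurable (Y v @^-1` [set y | 0 <= y]).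
      rewrite -[X in measurable X]setTI; apply: measurable_funPT => //.
      by rewrite -set_itvcy.
    exists (~` (Y v @^-1` [set y | 0 <= y])); split => //; first exact: measurableC.
    rewrite probability_setC// Ylaw ?mu_ge0 ?subee// -set_itvcy//.
  by apply: filterS2 y0 e0.
apply: filterS aeY => w hw _.
have {}hw v : v \in generation X n w -> 0 <= Y v w /\ 0 < E v w.
  move=> vg; have vn' : size v == n by apply/eqP; exact: generation_size vg.
  by have := hw (choice.pickle (Tuple vn')); rewrite choice.pickleK_inv.
congr (_%:E); rewrite indicE.
have [wA|wA] := boolP (w \in A).
  rewrite big_seq big1// => v vg; have [Y0 E0] := hw v vg.
  move: wA; rewrite inE /A /= => /bigmaxe_leP /(_ v vg).
  by rewrite -/(modified_position v w) (modified_position_le _ Y0 E0 vg) -/pw -/t => ->.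
have [v vg hv] : exists2 v, v \in generation X n w & H v w = 0.
  apply: contrapT => hn; move/negP: wA; apply; rewrite inE /A /=.
  apply/bigmaxe_leP => v vg; have [Y0 E0] := hw v vg.
  rewrite -/(modified_position v w) (modified_position_le _ Y0 E0 vg) -/pw -/t.
  apply: contrapT => /negP/negbTE h; apply: hn; exists v => //.
  by rewrite /H h.
by rewrite (perm_big _ (perm_to_rem vg)) big_cons -/(H v w) hv/= mul0r.
Qed.

(** * Integrating out the marks *)

Section two_stage.
Variable n : nat.
Hypothesis n_gt0 : (0 < n)%N.

Let idx := option (n.-tuple nat + n.-tuple nat).
Let F (i : idx) : set_system T :=
  match i with
  | None => brw_sigma X n
  | Some (inl v) => preimage_set_system setT (Y v) measurable
  | Some (inr v) => preimage_set_system setT (E v) measurable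
  end.

Let F_indep : mutually_independent P F.
Proof. by have [] := YE n_gt0. Qed.

Let F_sigma i : sigma_algebra setT (F i).
Proof.
case: i => [[v|v]|] /=; last exact: smallest_sigma_algebra.
- exact/sigma_algebra_preimage/sigma_algebra_measurable.
- exact/sigma_algebra_preimage/sigma_algebra_measurable.
Qed.

Let F_meas i : F i `<=` measurable.
Proof.
case: i => [[v|v]|] /=; last exact: brw_sigma_measurable.
- by move=> _ [B mB <-]; apply: measurable_funPT.
- by move=> _ [B mB <-]; apply: measurable_funPT.
Qed.

Let measurable_Y v : measurable_fun [set: g_sigma_algebraType (F (Some (inl v)))]
  (Y v : g_sigma_algebraType (F (Some (inl v))) -> R).
Proof.
move=> _ B mB; rewrite /measurable/= sigma_algebra_id; last exact: (F_sigma (Some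
  (inl v))).
by exists B.
Qed.

Let measurable_E v : measurable_fun [set: g_sigma_algebraType (F (Some (inr v)))]
  (E v : g_sigma_algebraType (F (Some (inr v))) -> R).
Proof.
move=> _ B mB; rewrite /measurable/= sigma_algebra_id; last exact: (F_sigma (Some
  (inr v))).
by exists B.
Qed.

Let hE (i : idx) (z : R * T) : R :=
  if i is Some (inr v) then (`|z.1| <= `|E v z.2|)%R%:R else 1.

Let hY (i : idx) (z : R * T) : R :=
  if i is Some (inl v) then expR (- `|z.1 * Y v z.2|) else 1.

Let hE_unit i z : 0 <= hE i z <= 1.
Proof.
case: i => [[v|v]|] /=; rewrite ?ler01 ?lexx//.
by case: (boolP (`|z.1| <= `|E v z.2|)); rewrite ?ler01 ?lexx.
Qed.

Let hY_unit i z : 0 <= hY i z <= 1.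
Proof.
case: i => [[v|v]|] /=; rewrite ?ler01 ?lexx//.
by rewrite expR_ge0 expR_le1 oppr_le0 normr_ge0.
Qed.

Let hE_meas i : measurable_fun [set: R * g_sigma_algebraType (F i)]
  (hE i : R * g_sigma_algebraType (F i) -> R).
Proof.
case: i => [[v|v]|]; [exact: measurable_cst| |exact: measurable_cst].
have mb : measurable_fun [set: R * g_sigma_algebraType (F (Some (inr v)))]
    (fun z : R * g_sigma_algebraType (F (Some (inr v))) => `|z.1| <= `|E v z.2|).
  apply: measurable_fun_ler.
    by apply: measurableT_comp; first exact: normr_measurable.
  apply: measurableT_comp; first exact: normr_measurable.
  exact: (measurableT_comp (@measurable_E v)).
rewrite (_ : hE _ = fun z => if `|z.1| <= `|E v z.2| then 1 else 0).
  exact: measurable_fun_ifT.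
by apply/funext => z; rewrite /hE; case: leP.
Qed.

Let hY_meas i : measurable_fun [set: R * g_sigma_algebraType (F i)]
  (hY i : R * g_sigma_algebraType (F i) -> R).
Proof.
case: i => [[v|v]|]; [|exact: measurable_cst|exact: measurable_cst].
apply: measurableT_comp => //; apply: measurableT_comp => //.
apply: measurableT_comp; first exact: normr_measurable.
apply: measurable_funM => //.
exact: (measurableT_comp (@measurable_Y v)).
Qed.

Let cond_hE v x : cond_mean P hE (Some (inr v)) x = expR (- `|x|).
Proof.
have [_ Elaw _] := YE n_gt0.
apply: EFin_inj; rewrite (cond_meanE P F_sigma F_meas hE_meas hE_unit).
rewrite -(exponential_norm_ge (Elaw v)).
set B := [set w | _].
have mB : measurable B.
  rewrite (_ : B = E v @^-1` (Num.norm @^-1` `[`|x|, +oo[%classic)).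
    rewrite -[X in measurable X]setTI; apply: measurable_funPT => //.
    rewrite -[X in measurable X]setTI.
    exact: (@normr_measurable R setT measurableT _ (measurable_itv _)).
  by apply/seteqP; split => w /=; rewrite in_itv/= andbT.
rewrite -[B in RHS]setIT -integral_indic//; apply: eq_integral => w _.
congr (_%:E); rewrite indicE /=; congr (nat_of_bool _)%:R.
by apply/idP/idP; rewrite inE.
Qed.

Let cond_hY v x : cond_mean P hY (Some (inl v)) x = laplace mu x.
Proof.
have [Ylaw _ _] := YE n_gt0.
rewrite /cond_mean /laplace /Rintegral; congr fine.
transitivity (\int[distribution P (Y v)]_y (expR (- (`|x| * `|y|)))%:E)%E.
  rewrite ge0_integral_distribution//.
  - by apply: eq_integral => w _; rewrite /= normrM.
  - apply/measurable_EFinP; apply: measurableT_comp => //; apply: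
      measurableT_comp => //.
    by apply: measurable_funM => //; exact: normr_measurable.
by apply: eq_measure_integral => A mA _; exact: Ylaw.
Qed.

Lemma lpm_max_prob_brw_mean x :
  P [set w | (lpm_max X Y E theta n w - (nu / theta * n%:R)%:E <= x%:E)%E] =
  (brw_mean P X theta nu n (laplace mu) (expR (- theta * x)))%:E.
Proof.
rewrite lpm_max_prob//; congr (_%:E); set t := expR _.
have mpw v : measurable_fun setT (pw t v) by exact: measurable_path_weightT.
pose H1 v w : R := (`|pw t v w * Y v w| <= `|E v w|)%R%:R.
pose H2 v w := expR (- `|pw t v w * Y v w|).
pose H3 v w := laplace mu (pw t v w).
have H101 v w : 0 <= H1 v w <= 1.
  by rewrite /H1; case: (boolP (`|pw t v w * Y v w| <= `|E v w|)); rewrite ?ler01 ?lexx.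
have mpwY v : measurable_fun setT (fun w => `|pw t v w * Y v w|).
  apply: measurableT_comp; first exact: normr_measurable.
  exact: measurable_funM.
have mH1 v : measurable_fun setT (H1 v).
  have mb : measurable_fun setT (fun w => `|pw t v w * Y v w| <= `|E v w|).
    apply: measurable_fun_ler => //.
    by apply: measurableT_comp; first exact: normr_measurable.
  rewrite (_ : H1 v = fun w => if `|pw t v w * Y v w| <= `|E v w| then 1 else 0).
    exact: measurable_fun_ifT.
  by apply/funext => w; rewrite /H1; case: leP.
have c1 : \int[P]_w \prod_(v <- first_words n K) H1 v w @[K --> \oo] -->
    \int[P]_w \prod_(v <- generation X n w) H1 v w.
  apply: Rintegral_first_words_cvg => // v w vn vg.
  by rewrite /H1 /pw (path_weight_dead _ _ _ vn vg) mul0r normr0 normr_ge0.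
have [l01 ll] := laplace_lip mu_ge0 mu_mean.
have c3 : \int[P]_w \prod_(v <- first_words n K) H3 v w @[K --> \oo] -->
    brw_mean P X theta nu n (laplace mu) t.
  apply: (Rintegral_first_words_cvg (H := H3)) => //.
  - move=> v; apply: measurableT_comp (mpw v); exact: lipschitz_measurable ll.
  - by move=> v w; exact: l01.
  - move=> v w vn vg.
    by rewrite /H3 /pw (path_weight_dead _ _ _ vn vg) laplace0.
apply: cvg_unique c1 _ => //.
rewrite (_ : (fun K => _) = fun K => \int[P]_w \prod_(v <- first_words n K) H3 v w)//.
apply/funext => K.
(* First stage: given the positions and all [Y], each [E v] turns its indicator into an
   exponential. *)
transitivity (\int[P]_w \prod_(v <- first_words n K) H2 v w).
  pose D : set idx := [set i | if i is Some (inr _) then False else True].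
  pose a (i : idx) w := if i is Some (inr v) then pw t v w * Y v w else 0.
  pose s : seq idx := [seq Some (inr v) | v <- first_words n K].
  have := Rintegral_prod_cond F_indep F_sigma F_meas (h := hE) (a := a)
    hE_meas hE_unit (D := D) (s := s) (f := cst 1).
  rewrite map_inj_uniq ?first_words_uniq; last by move=> v v' [].
  move=> /(_ isT) H.
  transitivity (\int[P]_w (cst 1 w * \prod_(i <- s) hE i (a i w, w))).
    by apply: eq_Rintegral => w _; rewrite mul1r big_map.
  rewrite H.
  - apply: eq_Rintegral => w _; rewrite mul1r big_map.
    by apply: eq_bigr => v _; rewrite cond_hE.
  - by move=> _ /mapP[v _ ->].
  - move=> _ /mapP[v _ ->]; apply: measurable_funM.
      have m1 := measurable_path_weight_brw (n := n) t (eq_leq (size_tuple v)).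
      exact: (measurableT_comp m1 (measurable_id_joint_sigma F_sigma (D := D) (i
        := None) I)).
    exact: (measurableT_comp (@measurable_Y v)
      (measurable_id_joint_sigma F_sigma (D := D) (i := Some (inl v)) I)).
  - exact: measurable_cst.
  - by move=> w; rewrite ler01 lexx.
(* Second stage: given the positions alone, each [Y v] turns the exponential into the Laplace
   transform of [mu]. *)
pose D : set idx := [set None].
pose a (i : idx) w := if i is Some (inl v) then pw t v w else 0.
pose s : seq idx := [seq Some (inl v) | v <- first_words n K].
have := Rintegral_prod_cond F_indep F_sigma F_meas (h := hY) (a := a)
  hY_meas hY_unit (D := D) (s := s) (f := cst 1).
rewrite map_inj_uniq ?first_words_uniq; last by move=> v v' [].
move=> /(_ isT) H.
transitivity (\int[P]_w (cst 1 w * \prod_(i <- s) hY i (a i w, w))).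
  by apply: eq_Rintegral => w _; rewrite mul1r big_map.
rewrite H.
- apply: eq_Rintegral => w _; rewrite mul1r big_map.
  by apply: eq_bigr => v _; rewrite cond_hY.
- by move=> _ /mapP[v _ ->].
- move=> _ /mapP[v _ ->].
  have m1 := measurable_path_weight_brw (n := n) t (eq_leq (size_tuple v)).
  exact: (measurableT_comp m1 (measurable_id_joint_sigma F_sigma (D := D) (i :=
    None) erefl)).
- exact: measurable_cst.
- by move=> w; rewrite ler01 lexx.
Qed.

End two_stage.
End last_progeny_modification.

(** * The limit law *)

Lemma random_variable_of_cdf (R : realType) (F : R -> R) :
  {homo F : x y / x <= y} -> continuous F ->
  F x @[x --> -oo] --> (0 : R) -> F x @[x --> +oo] --> (1 : R) ->
  exists (d : measure_display) (T : measurableType d) (P : probability T R)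
    (H : {RV P >-> R}), forall x, P [set w | H w <= x] = (F x)%:E.
Proof.
move=> ndF cF F0 F1.
have rcF : right_continuous F.
  by move=> x; apply: cvg_at_right_filter; exact: cF.
pose mixin1 := isCumulative.Build R _ R F ndF rcF.
pose mixin2 := isCumulativeBounded.Build R 0 1 F F0 F1.
pose Fc : cumulativeBounded (0 : R) (1 : R) := HB.pack F mixin1 mixin2.
pose P : probability _ R := lebesgue_stieltjes_measure Fc.
have mid : measurable_fun setT (idfun : measurableTypeR R -> R).
  exact: measurable_id.
exists _, _, P, (mfun_of mid) => x.
have := cdf_lebesgue_stieltjes_id Fc x.
rewrite /cdf /distribution /pushforward => <-.
by congr (_ _); apply/seteqP; split => w /=; rewrite in_itv.
Qed.

(** As [x] tends to [-oo] the argument of [phi] tends to [+oo], where the limit along integers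
    suffices by monotonicity. As [x] tends to [+oo] it tends to [0], where
    [phi t >= expR (- t) >= 1 - t]. *)
Lemma iter_smooth_limit_rv (R : realType) (phi : R -> R) (theta : R) :
  0 < theta -> unit_lip 1 phi ->
  (forall s t, 0 <= s <= t -> phi t <= phi s) ->
  (forall t, expR (- `|t|) <= phi t) ->
  phi k%:R @[k --> \oo] --> (0 : R) ->
  exists (d : measure_display) (T : measurableType d) (P : probability T R)
    (H : {RV P >-> R}),
    forall x, P [set w | H w <= x] = (phi (expR (- theta * x)))%:E.
Proof.
move=> theta0 [phi01 phil] phini phige phik.
have cphi : continuous phi.
  move=> x; apply/cvgrPdist_le => e e0; near=> y.
  apply: (le_trans (phil _ _)); rewrite mul1r.
  by near: y; have := @cvg_id _ (nbhs x); move/cvgrPdist_le; apply.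
have cexp : continuous (fun x : R => expR (- theta * x)).
  move=> x; apply: continuous_comp; last exact: continuous_expR.
  exact: mulrl_continuous.
apply: (@random_variable_of_cdf R (fun x => phi (expR (- theta * x)))).
- move=> x y xy; apply: phini; rewrite expR_ge0/= ler_expR.
  by rewrite !mulNr lerN2 ler_pM2l.
- move=> x; apply: (continuous_comp (f := fun x : R => expR (- theta * x))); last
    exact: cphi.
  exact: cexp.
- apply/cvgrPdist_le => e e0.
  have /cvgrPdist_le /(_ _ e0) [k _ hk] := phik.
  near=> x; rewrite sub0r normrN ger0_norm; last by case/andP: (phi01 (expR (-
    theta * x))).
  have := hk k (leqnn k); rewrite /= sub0r normrN => h.
  apply: le_trans (le_trans (ler_norm _) h); apply: phini.
  rewrite ler0n /=; apply: le_trans (expR_ge1Dx _).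
  apply: (@le_trans _ _ (- theta * x)); last by rewrite lerDr.
  rewrite mulNr -mulrN -ler_pdivrMl// lerNr.
  by near: x; apply: nbhs_ninfty_le; rewrite num_real.
- apply/cvgrPdist_le => e e0; near=> x.
  set t := expR (- theta * x).
  have h1 : phi t <= 1 by case/andP: (phi01 t).
  have h2 := phige t.
  have h3 := expR_ge1Dx (- `|t|).
  have h4 : t <= e.
    rewrite /t -[e]lnK ?posrE// ler_expR mulNr -lerN2 opprK.
    by rewrite -ler_pdivrMl//.
  have t0 : 0 <= t by exact: expR_ge0.
  rewrite !(ger0_norm t0) in h2 h3.
  by rewrite ger0_norm; lra.
Unshelve. all: by end_near. Qed.

Theorem theorem2p4 (R : realType)
    (d0 : measure_display) (T0 : measurableType d0) (P0 : probability T0 R)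
    (Z : point_process T0 R)
    (A1 : exists2 vartheta : R, 0 < vartheta &
            forall t : R, - vartheta < t -> (moment_gen P0 Z t < +oo)%E)
    (A2_branching : (P0 [set w | npts Z w = 1%N] < 1)%E)
    (A2_nondegenerate : forall t : R,
       (P0 [set w | pp_measure Z w [set t] = (npts Z w)%:R%:E] < 1)%E)
    (A2_nonempty : P0 [set w | (1 <= npts Z w)%N] = 1%E)
    (A3 : exists2 p : R, 0 < p &
            ('E_P0[fun w => ((npts Z w)%:R `^ (1 + p))%R] < +oo)%E)
    (theta : R) (theta_gt0 : 0 < theta)
    (theta_lt : (theta%:E < theta0 P0 Z)%E) :
  exists (dH : measure_display) (TH : measurableType dH)
         (PH : probability TH R) (H : {RV PH >-> R}),
  forall mu : probability R R,
    mu [set x : R | 0 <= x] = 1%E ->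
    ~ (forall A : set R, measurable A -> mu A = \d_(0 : R) A) ->
    (\int[mu]_x x%:E < +oo)%E ->
  forall (d : measure_display) (T : measurableType d) (P : probability T R)
         (X : seq nat -> point_process T R) (Y E : seq nat -> {RV P >-> R}),
    is_brw X P P0 Z ->
    is_modification X Y E P mu ->
    cvg_in_distribution P
      (fun n w => (lpm_max X Y E theta n w
                   - (log_moment_gen P0 Z theta / theta * n%:R)%:E)%E)
      PH (fun w => H w + theta^-1 * ln (fine (\int[mu]_x x%:E))).
Proof.
have [vartheta v0 mlty] := A1; have [p p0 Np] := A3.
have [q [q12 qp] kappa1] :=
  mean_weight_contraction v0 mlty A2_branching A2_nonempty theta_gt0 theta_lt p0.
have /andP[q1 _] := q12.
have sA := isint_weight v0 mlty A2_nonempty theta_gt0.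
have sAq := isint_weight_powR v0 mlty theta_gt0 (lt_trans ltr01 q1).
have [M sAM] := isint_total_weight_powR v0 mlty theta_gt0 q1 qp Np.
have mN := measurable_funPT (npts Z).
have mA := measurable_weight P0 Z theta.
have A0 := weight_gt0 P0 Z theta.
pose Gamma := smooth P0 (npts Z) (weight P0 Z theta).
pose phi := smooth_fix P0 (npts Z) (weight P0 Z theta).
have phiL : unit_lip 1 phi by exact: (smooth_fix_lip mN mA A0 sA sAq).
have phini s t : 0 <= s <= t -> phi t <= phi s by exact:
  (smooth_fix_nonincreasing mN mA A0 sA sAq).
have phige t : expR (- `|t|) <= phi t by exact: (smooth_fix_ge mN mA A0 sA sAq).
have phi0 : phi k%:R @[k --> \oo] --> 0.
  exact: (smooth_fix_cvg0 mN mA A0 q12 sA sAq sAM kappa1 A2_nonempty A2_branching).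
have [dH [TH [PH [H Hcdf]]]] := iter_smooth_limit_rv theta_gt0 phiL phini phige phi0.
exists dH, TH, PH, H => mu mu0 muN0 mum d T P X Y E XZ YE F x _.
have c0 : 0 < mean mu by exact: mean_gt0.
(* Shifting [H] by [theta^-1 * ln (mean mu)] multiplies the argument of [phi] by [mean mu]. *)
have -> : F x = (phi (mean mu * expR (- theta * x)))%:E.
  rewrite /F (_ : [set w | _] = [set w | H w <= x - theta^-1 * ln (mean mu)]);
    last first.
    by apply/seteqP; split => w /=; rewrite lerBrDr.
  rewrite Hcdf; congr (phi _)%:E.
  rewrite -{2}(lnK (x := mean mu)) ?posrE// -expRD; congr expR.
  by field; rewrite gt_eqF.
have lip := laplace_lip mu0 mum.
have cv := iter_smooth_cvg mN mA A0 sA sAq kappa1 lip (ltW c0)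
  (laplace_expansion mu0 mum q12) (expR_ge0 (- theta * x)).
apply: cvg_trans (_ : (iter n Gamma (laplace mu) (expR (- theta * x)))%:E @[n -->
  \oo] --> _).
  apply: near_eq_cvg; near=> n.
  (* The laws of the marks are prescribed from generation [1] on. *)
  have n0 : (0 < n)%N by near: n; exists 1%N.
  rewrite (lpm_max_prob_brw_mean (log_moment_gen P0 Z theta) theta_gt0 mu0 mum YE
    n0); congr (_%:E).
  by rewrite (brw_meanE XZ n _ (fun g gL => smooth_lip mN mA A0 sA sAq gL) lip
    (laplace0 mu)).
apply/fine_cvgP; split; first exact: nearW.
exact: cv.
Unshelve. all: by end_near. Qed.
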